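(* Let $E=\{(2,0)\}$, $\mu=\delta_{(2,0)}$, and $u((2,0);x,y,z)=x^2$. Then $A_\mu=2$ and $\mathcal T_\mu(S)\equiv1$, so $\int^\infty\sqrt{\mathcal T_\mu(S)}\,dS$ diverges. Nevertheless $F_\mu(x,y,z)=x^2x^{-2}=1$, and the metric completion of $(U_B,d_\mu)$ is the ordinary Euclidean closure $[0,\varepsilon]^2\times\overline B$ (the identity map of $U_B$ extends to a homeomorphism from the completion onto the Euclidean closure). In particular, every corner point occurs at finite distance.
   Context: Let $k\ge0$, let $V\subset\mathbb R^k$ be open, $0<\varepsilon<1$, $U=[0,\varepsilon)^2\times V$ with coordinates $(x,y,z)$, and let $g_0$ be a smooth Riemannian metric on $U$ with $c_0g_{\mathrm E}\le g_0\le C_0g_{\mathrm E}$, where $g_{\mathrm E}$ is the Euclidean metric and $0<c_0\le C_0<\infty$. Let $B$ be a Euclidean ball relatively compact in $V$ and $U_B=(0,\varepsilon)^2\times B$. For a finite positive measure $\mu$ with compact support $E$ and a positive coefficient $u(\alpha;x,y,z)$, put $F_\mu(x,y,z)=\int_E u(\alpha;x,y,z)x^{-\alpha_1}y^{-\alpha_2}\,d\mu(\alpha)$, $g_\mu=F_\mu g_0$, and let $d_\mu$ be the infimum of $g_\mu$-lengths of absolutely continuous curves in $U_B$. Put $A_\mu=\max_{\alpha\in E}(\alpha_1+\alpha_2)$ and $\mathcal T_\mu(S)=\int_E e^{-S(2-\alpha_1-\alpha_2)}\,d\mu(\alpha)$. The corner points are the points of $\{x=y=0\}\times B$. (Here $u$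 is not bounded below by a positive constant.) *)

(* Defs.v *)
From HB Require Import structures.
From mathcomp Require Export all_boot all_order all_algebra.
From mathcomp Require Export all_classical all_reals all_analysis.
Export numFieldNormedType.Exports.

Set Implicit Arguments.
Unset Strict Implicit.
Unset Printing Implicit Defensive.

Import Order.TTheory GRing.Theory Num.Theory.
Local Open Scope classical_set_scope.
Local Open Scope ring_scope.

Section Euclidean.
Context {R : realType}.

(* The library norm on row vectors is the sup norm, hence this one. *)
Definition enorm n (v : 'rV[R]_n) : R := Num.sqrt (\sum_(i < n) v 0 i ^+ 2).

Definition eball n (b : 'rV[R]_n) (r : R) : set 'rV[R]_n :=
  [set z | enorm (z - b) < r].

Definition quad n (A : 'M[R]_n) (v : 'rV[R]_n) : R := (v *m A *m v^T) 0 0.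

Fixpoint is_Cm n (m : nat) (O : set 'rV[R]_n) (f : 'rV[R]_n -> R) : Prop :=
  (forall p, O p -> {for p, continuous f}) /\
  match m with
  | 0%N => True
  | m'.+1 => forall i : 'I_n,
      (forall p, O p -> derivable f p (delta_mx 0 i)) /\
      is_Cm m' O ('D_(delta_mx 0 i) f)
  end.

(* [D] need not be open (here it has faces and corners): smoothness on [D]
   means that [f] extends smoothly to a neighbourhood of every point of [D]. *)
Definition smooth_on n (D : set 'rV[R]_n) (f : 'rV[R]_n -> R) : Prop :=
  forall p, D p -> exists (O : set 'rV[R]_n) (f' : 'rV[R]_n -> R),
    [/\ open O, O p, (forall m, is_Cm m O f') &
        forall q, O q -> D q -> f' q = f q].

Definition smooth_riemannian_metric n (D : set 'rV[R]_n)
    (g : 'rV[R]_n -> 'M[R]_n) : Prop :=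
  [/\ forall i j, smooth_on D (fun p => g p i j),
      forall p, D p -> (g p)^T = g p &
      forall p, D p -> forall v, v != 0 -> 0 < quad (g p) v].

(* c0 gE <= g <= C0 gE as quadratic forms *)
Definition euclidean_bounds n (D : set 'rV[R]_n) (c0 C0 : R)
    (g : 'rV[R]_n -> 'M[R]_n) : Prop :=
  forall p, D p -> forall v : 'rV[R]_n,
    c0 * enorm v ^+ 2 <= quad (g p) v <= C0 * enorm v ^+ 2.

Definition absolutely_continuous n (a b : R) (gam : R -> 'rV[R]_n) : Prop :=
  forall e : R, 0 < e -> exists2 d : R, 0 < d &
    forall (N : nat) (s t : 'I_N -> R),
      (forall i, a <= s i /\ s i <= t i /\ t i <= b) ->
      trivIset setT (fun i => `]s i, t i[%classic) ->
      \sum_(i < N) (t i - s i) < d ->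
      \sum_(i < N) enorm (gam (t i) - gam (s i)) < e.

Definition curve_length n (g : 'rV[R]_n -> 'M[R]_n) (I : set R)
    (gam : R -> 'rV[R]_n) : \bar R :=
  (\int[lebesgue_measure]_(t in I)
     (Num.sqrt (quad (g (gam t)) (derive1 gam t)))%:E)%E.

Definition path_dist n (D : set 'rV[R]_n) (g : 'rV[R]_n -> 'M[R]_n)
    (p q : 'rV[R]_n) : \bar R :=
  ereal_inf [set curve_length g `[0, 1] gam | gam in
    [set gam : R -> 'rV[R]_n |
      [/\ absolutely_continuous 0 1 gam,
          (forall t, `[0, 1]%classic t -> D (gam t)),
          gam 0 = p & gam 1 = q]]].

(* The curve stays in [D] until it reaches the ideal point [q] at time 1. *)
Definition reached_with_finite_length n (D : set 'rV[R]_n)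
    (g : 'rV[R]_n -> 'M[R]_n) (p q : 'rV[R]_n) : Prop :=
  exists gam : R -> 'rV[R]_n,
    [/\ (forall t, 0 <= t < 1 -> absolutely_continuous 0 t gam),
        (forall t, 0 <= t < 1 -> D (gam t)),
        gam 0 = p, gam t @[t --> 1^'-] --> q &
        (curve_length g `[0%R, 1%R[ gam < +oo)%E].

End Euclidean.

Section Completion.
Context {R : realType}.

Definition is_metric_completion (T : Type) (D : set T) (d : T -> T -> \bar R)
    (X : metricType R) (iota : T -> X) : Prop :=
  [/\ forall p q, D p -> D q -> d p q = (mdist (iota p) (iota q))%:E,
      dense (iota @` D) &
      forall F : set_system X, ProperFilter F -> cauchy F -> exists x : X, F --> x].

Definition homeomorphism_onto (X Y : topologicalType) (C : set Y)
    (h : X -> Y) : Prop :=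
  [/\ continuous h, range h = C &
      exists h' : Y -> X, cancel h h' /\ {within C, continuous h'}].

End Completion.

Section CornerModel.
Context {R : realType}.

Definition cx k (p : 'rV[R]_(2 + k)) : R := lsubmx p 0 0.
Definition cy k (p : 'rV[R]_(2 + k)) : R := lsubmx p 0 1.
Definition cz k (p : 'rV[R]_(2 + k)) : 'rV[R]_k := rsubmx p.

Definition box k (I : set R) (W : set 'rV[R]_k) : set 'rV[R]_(2 + k) :=
  [set p | [/\ I (cx p), I (cy p) & W (cz p)]].

Definition corner_points k (B : set 'rV[R]_k) : set 'rV[R]_(2 + k) :=
  box [set 0] B.

Variable mu : {measure set (measurableTypeR R * measurableTypeR R) -> \bar R}.

Definition msupport : set (R * R) :=
  [set a | forall O : set (R * R), open O -> O a -> (0 < mu O)%E].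

Definition F_mu k (u : R * R -> 'rV[R]_(2 + k) -> R) (p : 'rV[R]_(2 + k)) : R :=
  \int[mu]_(a in msupport) (u a p * cx p `^ (- a.1) * cy p `^ (- a.2)).

Definition g_mu k (u : R * R -> 'rV[R]_(2 + k) -> R)
    (g0 : 'rV[R]_(2 + k) -> 'M[R]_(2 + k)) (p : 'rV[R]_(2 + k)) :=
  F_mu u p *: g0 p.

Definition maximum (S : set R) : R := xget 0 (S `&` ubound S).

Definition A_mu : R := maximum [set a.1 + a.2 | a in msupport].

Definition T_mu (S : R) : R :=
  \int[mu]_(a in msupport) expR (- S * (2 - a.1 - a.2)).

End CornerModel.

(* Main.v *)
From HB Require Import structures.
Require Import Defs.
From mathcomp Require Import lra ring measurable_realfun.
Import Order.TTheory GRing.Theory Num.Theory.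
Set Implicit Arguments.
Unset Strict Implicit.
Unset Printing Implicit Defensive.
Local Open Scope classical_set_scope.
Local Open Scope ring_scope.

(** On [UB] the coefficient [x ^+ 2] cancels the weight [x `^ -2], so
    [F_mu = 1] and [d] is the path distance of [g0].  This distance is
    bi-Lipschitz equivalent to the norm distance.  The upper bound comes from
    segments, [UB] being convex.  For the lower bound one needs that an
    absolutely continuous curve is differentiable almost everywhere and is the
    integral of its derivative: each coordinate is a difference of two
    nondecreasing absolutely continuous functions (its total variation [V] and
    [V - f]), the Lebesgue-Stieltjes measure of such a function is dominated by
    the Lebesgue measure, and one concludes with the Radon-Nikodym theorem and
    the Lebesgue differentiation theorem.  Finally, any completion of [UB] for
    a distance bi-Lipschitz equivalent to the norm is homeomorphic to the
    closure of [UB]. *)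

(** * Absolute continuity and total variation *)

(** The length integral alone does not see the endpoints of a curve: along a Cantor-type curve it
    vanishes while the endpoints differ. The lower bound therefore rests on the fundamental theorem
    of calculus for absolutely continuous functions. It is enough to bound one coordinate at a time,
    because the library norm is the maximum of the coordinates; only real-valued integrals then
    occur. Almost everywhere differentiability is used a second time for symmetry and the triangle
    inequality, where the chain rule for an affine change of time is applied off a null set. The
    bi-Lipschitz constants are [Num.sqrt c0] from below and [Num.sqrt C0] times the dimension plus
    one from above, the last factor comparing the Euclidean norm with the maximum norm. *)

Section AbsCont.
Context {R : realType}.

(* Absolute continuity of a function [D] of intervals.  Both [enorm (gam t - gam s)]
   and increments of total variation are instances, and reparametrizations and
   sums of curves become operations on [D]. *)
Definition acont (a b : R) (D : R -> R -> R) : Prop :=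
  forall e : R, 0 < e -> exists2 d : R, 0 < d &
    forall (I : finType) (s t : I -> R),
      (forall i, [/\ a <= s i, s i <= t i & t i <= b]) ->
      (forall i j, i != j -> s i < t i -> s j < t j -> t i <= s j \/ t j <= s i) ->
      \sum_i (t i - s i) < d -> \sum_i D (s i) (t i) < e.

Lemma oo_disjoint (s t s' t' : R) : s < t -> s' < t' ->
  `]s, t[%classic `&` `]s', t'[%classic = set0 <-> t <= s' \/ t' <= s.
Proof.
move=> st st'; split => [dis|].
- have [?|s't] := leP t s'; [by left|right].
  rewrite leNgt; apply/negP => st'2.
  have mM : Num.max s s' < Num.min t t' by rewrite lt_min !gt_max st st' s't st'2.
  have : (`]s, t[%classic `&` `]s', t'[%classic) ((Num.max s s' + Num.min t t') / 2).
    have [h1 h2] := midf_lt mM.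
    move: h1 h2; rewrite gt_max lt_min => /andP[h1 h2] /andP[h3 h4].
    by split; rewrite /= in_itv/= ?h1 ?h2.
  by rewrite dis.
- move=> h; rewrite -subset0 => x [] /=; rewrite !in_itv/= => /andP[sx xt] /andP[sx' xt'].
  by case: h => h; [have := lt_trans sx' (lt_le_trans xt h)|
    have := lt_trans sx (lt_le_trans xt' h)]; rewrite ltxx.
Qed.

(** An empty open interval is disjoint from every set, so [acont] can impose its order condition on
    nondegenerate intervals only; [enum_val] turns an arbitrary finite index type into an
    ordinal. *)
Lemma absolutely_continuousE n (a b : R) (gam : R -> 'rV[R]_n) :
  absolutely_continuous a b gam <-> acont a b (fun s t => enorm (gam t - gam s)).
Proof.
split=> H e e0; have [d d0 {}H] := H e e0; exists d => //.
- move=> I s t st dis lt_d.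
  have := H #|I| (fun i => s (enum_val i)) (fun i => t (enum_val i)).
  have E (F : I -> R) : \sum_i F i = \sum_(j < #|I|) F (enum_val j).
    by rewrite (reindex (@enum_val I I))//; exact/onW_bij/enum_val_bij.
  rewrite -(E (fun i => t i - s i)) -(E (fun i => enorm (gam (t i) - gam (s i)))).
  apply.
  + by move=> i; have [] := st (enum_val i).
  + apply/trivIsetP => i j _ _ ij.
    have [stj|] := ltP (s (enum_val j)) (t (enum_val j)); last first.
      by move=> stj; rewrite [X in _ `&` X]set_itv_ge ?setI0// bnd_simp -leNgt.
    have [sti|] := ltP (s (enum_val i)) (t (enum_val i)); last first.
      by move=> sti; rewrite set_itv_ge ?set0I// bnd_simp -leNgt.
    apply/oo_disjoint => //; apply: dis => //.
    by apply: contra ij => /eqP/enum_val_inj ->.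
  + by [].
- move=> N s t st dis lt_d; apply: H => //.
  + by move=> i; have [? []] := st i.
  + move=> i j ij sti stj; apply/oo_disjoint => //.
    by move/trivIsetP : dis; apply.
Qed.

Lemma acont_le (a b : R) D D' : (forall s t, a <= s -> s <= t -> t <= b -> D' s t <= D s t) ->
  acont a b D -> acont a b D'.
Proof.
move=> DD' H e e0; have [d d0 {}H] := H e e0; exists d => // I s t st dis ltd.
apply: le_lt_trans (H _ _ _ st dis ltd).
by apply: ler_sum => i _; have [? ? ?] := st i; exact: DD'.
Qed.

Lemma acontD (a b : R) D D' : acont a b D -> acont a b D' ->
  acont a b (fun s t => D s t + D' s t).
Proof.
move=> H H' e e0; have e20 : 0 < e / 2 by rewrite divr_gt0.
have [d d0 {}H] := H _ e20; have [d' d'0 {}H'] := H' _ e20.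
exists (Num.min d d') => [|I s t st dis]; first by rewrite lt_min d0.
rewrite lt_min => /andP[ltd ltd'].
by rewrite big_split (splitr e) ltrD// ?H ?H'.
Qed.

(** Monotonicity keeps the image intervals ordered, and a nondegenerate image forces a nondegenerate
    source. Clamping to an interval and the changes of time of a concatenation are of this kind. *)
Lemma acont_comp_nd (a b a' b' K : R) (phi : R -> R) D :
  (forall s, a' <= s <= b' -> a <= phi s <= b) ->
  (forall s t, a' <= s -> s <= t -> t <= b' -> phi s <= phi t /\ phi t - phi s <= K * (t - s)) ->
  acont a b D -> acont a' b' (fun s t => D (phi s) (phi t)).
Proof.
move=> phiab phiL H e e0; have [d d0 {}H] := H e e0.
have K0 : 0 < `|K| + 1 by rewrite ltr_wpDl.
exists (d / (`|K| + 1)) => [|I s t st dis ltd]; first by rewrite divr_gt0.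
apply: H.
- move=> i; have [as_ s_t tb] := st i.
  have /andP[? ?] : a <= phi (s i) <= b by rewrite phiab// as_ (le_trans s_t).
  have /andP[? ?] : a <= phi (t i) <= b by rewrite phiab// tb (le_trans as_).
  by split=> //; apply: (phiL _ _ _ _ _).1.
- move=> i j ij pi pj.
  have [asi s_ti tbi] := st i; have [asj s_tj tbj] := st j.
  have si : s i < t i.
    by rewrite lt_neqAle s_ti andbT; apply/eqP => E; move: pi; rewrite E ltxx.
  have sj : s j < t j.
    by rewrite lt_neqAle s_tj andbT; apply/eqP => E; move: pj; rewrite E ltxx.
  have [h|h] := dis _ _ ij si sj; [left|right].
    by apply: (phiL _ _ _ h _).1; [exact: le_trans s_ti|exact: le_trans tbj].
  by apply: (phiL _ _ _ h _).1; [exact: le_trans s_tj|exact: le_trans tbi].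
- move: ltd; rewrite ltr_pdivlMr// => /le_lt_trans; apply.
  rewrite mulrC mulr_sumr; apply: ler_sum => i _.
  have [as_ s_t tb] := st i.
  apply: le_trans (phiL _ _ as_ s_t tb).2 _.
  by rewrite ler_wpM2r ?subr_ge0// (le_trans (ler_norm _))// lerDl.
Qed.

Lemma acont_comp_ni (a b : R) D :
  acont a b D -> acont (- b) (- a) (fun s t => D (- t) (- s)).
Proof.
move=> H e e0; have [d d0 {}H] := H e e0; exists d => // I s t st dis ltd.
apply: (H I (fun i => - t i) (fun i => - s i)).
- by move=> i; have [? ? ?] := st i; split; rewrite ?lerN2// ?(lerNr a)// lerNl.
- by move=> i j ij; rewrite !ltrN2 => si sj; rewrite !lerN2; have [] := dis _ _ ij si sj; [right|left].
- by under eq_bigr do rewrite opprK addrC.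
Qed.

Lemma partition_nth (s t : R) l (j : nat) : itv_partition s t l -> (j < size l)%N ->
  [/\ s <= nth t (s :: l) j, nth t (s :: l) j <= nth t (s :: l) j.+1 & nth t (s :: l) j.+1 <= t].
Proof.
move=> pl jl; split.
- by apply: itv_partition_nth_ge => //; rewrite ltnS ltnW.
- have := @nondecreasing_fun_itv_partition _ _ s t id l (fun x y _ _ => id) pl j jl.
  by [].
- exact: itv_partition_nth_le.
Qed.

Lemma partition_nth_le (s t : R) l (i j : nat) : itv_partition s t l ->
  (i <= j)%N -> (j <= size l)%N -> nth t (s :: l) i <= nth t (s :: l) j.
Proof.
move=> pl; elim: j => [|j IH]; first by rewrite leqn0 => /eqP ->.
rewrite leq_eqVlt => /orP[/eqP -> //|ij] jl.
have [_ h _] := partition_nth pl jl.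
by apply: le_trans h; apply: IH => //; exact: ltnW.
Qed.

(** The cells of the partitions of all the intervals form a single disjoint family, indexed by a
    sigma type, whose total length telescopes to that of the original intervals; the modulus [d] of
    [f] therefore serves unchanged. *)
Lemma acont_variation (a b : R) (f : R -> R) : acont a b (fun s t => `|f t - f s|) ->
  forall e : R, 0 < e -> exists2 d : R, 0 < d &
    forall (I : finType) (s t : I -> R) (l : I -> seq R),
      (forall i, [/\ a <= s i, s i <= t i & t i <= b]) ->
      (forall i j, i != j -> s i < t i -> s j < t j -> t i <= s j \/ t j <= s i) ->
      (forall i, itv_partition (s i) (t i) (l i)) ->
      \sum_i (t i - s i) < d -> \sum_i variation (s i) (t i) f (l i) < e.
Proof.
move=> H e e0; have [d d0 {}H] := H e e0; exists d => // I s t l st dis pl ltd.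
pose J : finType := {i : I & 'I_(size (l i))}.
pose s' (x : J) := nth (t (tag x)) (s (tag x) :: l (tag x)) (tagged x).
pose t' (x : J) := nth (t (tag x)) (s (tag x) :: l (tag x)) (tagged x).+1.
have E (F : I -> nat -> R) :
    \sum_i \sum_(0 <= n < size (l i)) F i n = \sum_(x : J) F (tag x) (tagged x).
  under eq_bigr do rewrite big_mkord.
  by rewrite (@sig_big_dep _ _ _ _ _ xpredT (fun _ => xpredT) (fun i (j : 'I_(size (l i))) => F i j)).
have := H J s' t'; rewrite /variation E; apply.
- move=> [i j]; have [? ? ?] := st i.
  have [? ? ?] := partition_nth (pl i) (ltn_ord j).
  by split => //; [exact: le_trans (_ : s i <= _)|exact: le_trans (_ : t i <= b)].
- move=> [i j] [i' j']; rewrite /s' /t' /= => ij.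
  have [ii'|ii'] := eqVneq i i'.
    subst i'; have jj' : (j : nat) != j'.
      by apply: contra ij => /eqP/val_inj ->.
    move=> _ _; have [jj|jj|jj] := ltngtP (j : nat) (j' : nat).
    + by left; exact: (partition_nth_le (pl i) jj (ltnW (ltn_ord j'))).
    + by right; exact: (partition_nth_le (pl i) jj (ltnW (ltn_ord j))).
    + by rewrite jj eqxx in jj'.
  move=> h h'.
  have [p1 p2 p3] := partition_nth (pl i) (ltn_ord j).
  have [q1 q2 q3] := partition_nth (pl i') (ltn_ord j').
  have [||k|k] := dis i i' ii'.
  + exact: le_lt_trans p1 (lt_le_trans h p3).
  + exact: le_lt_trans q1 (lt_le_trans h' q3).
  + by left; apply: le_trans p3 (le_trans k q1).
  + by right; apply: le_trans q3 (le_trans k p1).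
- apply: le_lt_trans ltd; rewrite -(E (fun i n => nth (t i) (s i :: l i) n.+1 - nth (t i) (s i :: l i) n)).
  apply: ler_sum => i _; rewrite telescope_sumr//= (itv_partition_nth_size _ (pl i)).
  by [].
Qed.

(** Partitions almost attaining the supremum are chosen in all the intervals at once; the passage to
    the supremum makes the bound non-strict. *)
Lemma acont_total_variation (a b : R) (f : R -> R) : acont a b (fun s t => `|f t - f s|) ->
  forall e : R, 0 < e -> exists2 d : R, 0 < d &
    forall (I : finType) (s t : I -> R),
      (forall i, [/\ a <= s i, s i <= t i & t i <= b]) ->
      (forall i j, i != j -> s i < t i -> s j < t j -> t i <= s j \/ t j <= s i) ->
      \sum_i (t i - s i) < d ->
      (\sum_i total_variation (s i) (t i) f <= e%:E)%E.
Proof.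
move=> H e e0; have [d d0 {}H] := acont_variation H e0; exists d => // I s t st dis ltd.
have part i : exists l, itv_partition (s i) (t i) l.
  have [_ + _] := st i; rewrite le_eqVlt => /predU1P[->|h]; first by exists [::]; split.
  by exists [:: t i]; exact: itv_partition1.
have [l0 pl0] := choice part.
(* Near-optimal partitions require a finite supremum. Finiteness comes from the same modulus, since
   each interval of the family is itself shorter than [d]. *)
have tv_fin i : total_variation (s i) (t i) f \is a fin_num.
  have [? ? ?] := st i.
  apply/bounded_variationP => //; exists e => _ [l pl <-].
  have -> : variation (s i) (t i) f l = \sum_(x < 1) variation (s i) (t i) f l.
    by rewrite big_ord1.
  apply/ltW/(H 'I_1 (fun _ => s i) (fun _ => t i) (fun _ => l)) => //.
  - by move=> i1 i2; rewrite !ord1 eqxx.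
  - rewrite big_ord1; apply: le_lt_trans ltd.
    rewrite (bigD1 i)//= lerDl sumr_ge0// => j _.
    by have [_ + _] := st j; rewrite subr_ge0.
apply/lee_addgt0Pr => eta eta0.
(* The error [eta] is shared among the intervals; adding 1 to their number avoids a zero denominator
   for an empty family. *)
pose eta' := eta / (#|I|%:R + 1).
have eta'0 : 0 < eta' by rewrite divr_gt0// ltr_wpDl.
have near_opt i : exists l, itv_partition (s i) (t i) l /\
    fine (total_variation (s i) (t i) f) - eta' < variation (s i) (t i) f l.
  have : ((fine (total_variation (s i) (t i) f) - eta')%:E < total_variation (s i) (t i) f)%E.
    by rewrite EFinB fineK// lteBlDr// lteDl// lte_fin.
  by move=> /ereal_sup_gt[_ [_ [l pl <-] <-]]; rewrite lte_fin => h; exists l.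
have [l hl] := choice near_opt.
have := H I s t l st dis (fun i => (hl i).1) ltd.
move=> /ltW le_e.
rewrite (eq_bigr (fun i => (fine (total_variation (s i) (t i) f))%:E)); last by move=> i _; rewrite fineK.
rewrite sumEFin -EFinD lee_fin.
apply: le_trans (_ : \sum_i (variation (s i) (t i) f (l i) + eta') <= _).
  by apply: ler_sum => i _; rewrite -lerBlDr ltW// (hl i).2.
rewrite big_split/= lerD// sumr_const -mulr_natl /eta' mulrA ler_pdivrMr ?ltr_wpDl//.
by rewrite mulrC ler_wpM2l ?(ltW eta0)// lerDl.
Qed.

End AbsCont.

(** * The variation function and continuity *)

Section AbsContReal.
Context {R : realType}.
Implicit Types (a b : R) (f G : R -> R).

(** The modulus for 1 bounds the variation over any interval shorter than [d]; induction on the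
    number of steps of length [d / 2] peels off the last piece of the interval. *)
Lemma acont_bounded_variation a b f : a <= b -> acont a b (fun s t => `|f t - f s|) ->
  bounded_variation a b f.
Proof.
move=> ab H; apply/bounded_variationP => //.
have [d d0 {}H] := acont_total_variation H (ltr01 : 0 < (1 : R)).
have d20 : 0 < d / 2 by rewrite divr_gt0.
suff K m x : a <= x -> x <= b -> x - a <= (d / 2) *+ m -> total_variation a x f \is a fin_num.
  have /archi_boundP hm : 0 <= (b - a) / (d / 2) by rewrite divr_ge0 ?subr_ge0// ltW.
  apply: (K (Num.Def.archi_bound ((b - a) / (d / 2)))) => //.
  by rewrite -mulr_natl -ler_pdivrMr// ltW.
elim: m x => [x ax _|m IH x ax xb].
  by rewrite mulr0n subr_le0 => xa; have -> : x = a; [exact/le_anti/andP|rewrite total_variationxx].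
rewrite mulrSr => xm.
pose c := Num.max a (x - d / 2).
have ac : a <= c by rewrite le_max lexx.
have cx : c <= x by rewrite ge_max ax lerBlDr lerDl ltW.
rewrite (total_variationD f ac cx) fin_numD; apply/andP; split.
  apply: IH => //; first exact: le_trans cx xb.
  rewrite /c maxEle; case: ifPn => _; last by rewrite subrr mulrn_wge0// ltW.
  by rewrite addrAC lerBlDr.
rewrite ge0_fin_numE ?total_variation_ge0//.
have := H 'I_1 (fun=> c) (fun=> x); rewrite !big_ord1 => /(_ _ _ _)/le_lt_trans-> //.
- by move=> i j; rewrite !ord1 eqxx.
- rewrite ltrBlDl -ltrBlDr lt_max; apply/orP; right.
  by rewrite ltrD2l ltrN2 ltr_pdivrMr// ltr_pMr// ltr1n.
- by rewrite ltry.
Qed.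

(** Additivity of the total variation identifies an increment of [V] with the variation over the
    interval in between, so the bound on sums of variations becomes absolute continuity of [V]. *)
Lemma acont_fine_tv a b f : a <= b -> acont a b (fun s t => `|f t - f s|) ->
  let V := fun x => fine (total_variation a x f) in
  acont a b (fun s t => V t - V s) /\
  (forall s t, a <= s -> s <= t -> t <= b -> `|f t - f s| <= V t - V s).
Proof.
move=> ab H V.
have bv := acont_bounded_variation ab H.
have fin s t : a <= s -> s <= t -> t <= b -> total_variation s t f \is a fin_num.
  move=> as_ st tb; apply/bounded_variationP => //.
  apply: (@bounded_variationl _ _ _ b) => //.
  by apply: (@bounded_variationr _ a) => //; exact: le_trans tb.
have VE s t : a <= s -> s <= t -> t <= b -> (V t - V s)%:E = total_variation s t f.
  move=> as_ st tb; have at_ := le_trans as_ st; have sb := le_trans st tb.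
  by rewrite /V EFinB !fineK ?fin// (total_variationD f as_ st) addeAC subee ?add0e// fin.
split=> [e e0|s t as_ st tb]; last by rewrite -lee_fin VE// total_variation_ge.
have e20 : 0 < e / 2 by rewrite divr_gt0.
have [d d0 {}H] := acont_total_variation H e20; exists d => // I s t st dis ltd.
have := H I s t st dis ltd.
rewrite (eq_bigr (fun i => (V (t i) - V (s i))%:E)); last first.
  by move=> i _; have [? ? ?] := st i; rewrite VE.
rewrite sumEFin lee_fin => /le_lt_trans; apply.
by rewrite ltr_pdivrMr// ltr_pMr// ltr1n.
Qed.

Lemma acont_continuous G : (forall a b, acont a b (fun s t => `|G t - G s|)) -> continuous G.
Proof.
move=> H x; apply/cvgrPdist_lt => e e0.
have [d d0 {}H] := H (x - 1) (x + 1) e e0.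
near=> y.
have : `|x - y| < d by near: y; apply: cvgr_dist_lt => //; exact: cvg_id.
have : `|x - y| < 1 by near: y; apply: cvgr_dist_lt => //; exact: cvg_id.
rewrite ltr_norml ltrBlDr ltrBrDr => /andP[y1 y2] xyd.
have {}H s t : x - 1 <= s -> s <= t -> t <= x + 1 -> t - s < d -> `|G t - G s| < e.
  move=> ? ? ? ?; have := H 'I_1 (fun=> s) (fun=> t); rewrite !big_ord1; apply => //.
  by move=> i j; rewrite !ord1 eqxx.
have [xy|yx] := leP x y.
  rewrite distrC H//; first by rewrite gerBl.
    by rewrite ltW//; move: y1; lra.
  by rewrite (le_lt_trans _ xyd)// distrC ler_norm.
rewrite H//; first by move: y2; lra.
- by rewrite ltW.
- by rewrite lerDl.
by rewrite (le_lt_trans _ xyd)// ler_norm.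
Unshelve. all: by end_near. Qed.

End AbsContReal.

(** * Almost everywhere differentiability *)

Section StieltjesAC.
Context {R : realType}.
Implicit Types (a b : R).
Local Notation lambda := (@lebesgue_measure R).

Lemma stieltjes_itv_oc (G : cumulative R R) (s t : R) : s <= t ->
  lebesgue_stieltjes_measure G `]s, t] = (G t - G s)%:E.
Proof.
move=> st; rewrite /lebesgue_stieltjes_measure /measure_extension/=.
by rewrite measurable_mu_extE/= ?wlength_itv_bnd//; exact: is_ocitv.
Qed.

(** The two inclusions serve different measures: the open interval bounds the Lebesgue measure of
    [I] from below, the half-open one bounds its Stieltjes measure from above. The ends are the
    infimum and the supremum, except that the empty set gets the degenerate pair [(a, a)]. *)
Lemma open_itv_bounds (I : set R) (a b : R) : open I -> is_interval I -> I `<=` `]a, b[ -> a <= b ->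
  exists st : R * R, [/\ a <= st.1 /\ st.1 <= st.2, st.2 <= b,
    `]st.1, st.2[ `<=` I & I `<=` `]st.1, st.2] ].
Proof.
move=> oI iI Iab ab.
have [->|/set0P I0] := eqVneq I set0.
  by exists (a, a); split => //= x /=; rewrite in_itv/= => /andP[/lt_trans/[apply]]; rewrite ltxx.
have lI : has_inf I by split=> //; exists a => x /Iab/=; rewrite in_itv/= => /andP[/ltW].
have uI : has_sup I by split=> //; exists b => x /Iab/=; rewrite in_itv/= => /andP[_ /ltW].
have inf_le x : I x -> inf I <= x by move=> Ix; exact: (ge_inf lI.2).
have sup_ge x : I x -> x <= sup I by move=> Ix; apply: ub_le_sup => //; exact: uI.2.
exists (inf I, sup I); split => /=.
- split; first by apply: lb_le_inf => // x /Iab/=; rewrite in_itv/= => /andP[/ltW].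
  by have [x Ix] := I0; exact: le_trans (inf_le _ Ix) (sup_ge _ Ix).
- by apply: ge_sup => // x /Iab/=; rewrite in_itv/= => /andP[_ /ltW].
- move=> x /=; rewrite in_itv/= => /andP[ix xs].
  have [y Iy yx] := inf_lt lI.1 ix; have [z Iz xz] := sup_gt uI.1 xs.
  by apply: (iI _ _ Iy Iz); rewrite (ltW yx) (ltW xz).
- move=> x Ix /=; rewrite in_itv/= sup_ge// andbT lt_neqAle inf_le// andbT.
  apply/eqP => xE.
  have : nbhs x I by rewrite nbhsE/=; exists I.
  move=> /nbhs_ballP[/= e e0 xe].
  have : I (x - e / 2).
    by apply: xe; rewrite /ball/= opprB addrC subrK gtr0_norm ?divr_gt0//
      ltr_pdivrMr// ltr_pMr// ltr1n.
  by move/inf_le; rewrite xE => h; move: e0 h; lra.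
Qed.

(** A null set lies in an open set of measure below the modulus [d]; the increments of [G] over the
    components of that open set are then controlled by [e]. *)
Lemma stieltjes_null (G : cumulative R R) a b (A : set R) : a <= b ->
  acont a b (fun s t => `|G t - G s|) -> measurable A -> lambda A = 0%E -> A `<=` `]a, b[ ->
  lebesgue_stieltjes_measure G A = 0%E.
Proof.
move=> ab H mA A0 Aab.
pose nu : {measure set (measurableTypeR R) -> \bar R} := lebesgue_stieltjes_measure G.
rewrite -[lebesgue_stieltjes_measure G]/(nu : set _ -> _).
apply/eqP; rewrite eq_le measure_ge0 andbT; apply/lee_addgt0Pr => e e0; rewrite add0e.
have [d d0 {}H] := H _ e0.
have Afin : (lambda A < +oo)%E by rewrite A0 ltry.
have [U0 [oU0 AU0 lU0]] := lebesgue_regularity_outer mA Afin d0.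
(* Cutting with []a, b[] brings every component into the interval where the modulus applies. *)
pose U := U0 `&` `]a, b[%classic.
have oU : open U by apply: openI => //; exact: itv_open.
have AU : A `<=` U by move=> x Ax; split; [exact: AU0|exact: Aab].
have mU : measurable U by exact: open_measurable.
have mU0 : measurable U0 by exact: open_measurable.
have lU : (lambda U < d%:E)%E.
  apply: le_lt_trans lU0; apply: le_trans (_ : lambda U0 <= _)%E.
    by apply: le_measure; rewrite ?inE//; exact: subIsetl.
  have -> : lambda U0 = (lambda (U0 `\` A) + lambda (U0 `&` A))%E by exact: measureDI.
  rewrite (_ : lambda (U0 `&` A) = 0%E) ?adde0//.
  by apply/eqP; rewrite -measure_le0 -A0 le_measure ?inE//; exact: measurableI.
pose I := open_disjoint_itv oU.
have UE : U = \bigcup_q I q by exact: open_disjoint_itv_bigcup.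
have trI : trivIset setT I by exact: open_disjoint_itv_trivIset.
have oI q : open (I q) by exact: open_disjoint_itv_open.
have mI q : measurable (I q) by exact: open_measurable.
have bI q : exists st : R * R, [/\ a <= st.1 /\ st.1 <= st.2, st.2 <= b,
    `]st.1, st.2[ `<=` I q & I q `<=` `]st.1, st.2] ].
  apply: open_itv_bounds => //; first exact: open_disjoint_itv_is_interval.
  by move=> x Ix; have : U x; [rewrite UE; exists q|case].
have [st hst] := choice bI.
apply: (@le_trans _ _ (nu U)); first by apply: le_measure; rewrite ?inE.
rewrite UE (@measure_bigcup _ _ _ nu)//; last by move=> q _; exact: mI.
(* The countable sum is reached through its partial sums, as absolute continuity speaks of finite
   families. *)
apply: lime_le; first by apply: is_cvg_nneseries => *; exact: measure_ge0.
apply: nearW => n; rewrite big_mkord (eq_bigl xpredT); last by move=> q; rewrite in_setT.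
apply: (@le_trans _ _ (\sum_(q < n) (`|G (st q).2 - G (st q).1|)%:E)%E).
  apply: lee_sum => q _; have [[? h] _ _ sub] := hst q.
  have le1 : (nu (I q) <= nu `](st q).1, (st q).2]%classic)%E.
    by apply: le_measure => //; rewrite inE; [exact: mI|exact: measurable_itv].
  apply: (le_trans le1).
  by rewrite [leLHS](stieltjes_itv_oc G h) lee_fin ler_norm.
rewrite sumEFin lee_fin ltW//.
apply: (H 'I_n (fun q => (st q).1) (fun q => (st q).2)).
- by move=> q; have [[? ?] ? _ _] := hst q.
- move=> i j ij si sj; apply/oo_disjoint => //.
  have [_ _ subi _] := hst i; have [_ _ subj _] := hst j.
  rewrite -subset0 => x [/subi xi /subj xj].
  have := trI i j Logic.I Logic.I (ex_intro _ x (conj xi xj)).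
  by move/val_inj/eqP; rewrite (negbTE ij).
- rewrite -lte_fin -sumEFin; apply: le_lt_trans lU.
  apply: (@le_trans _ _ (\sum_(q < n) lambda (I q))%E).
    apply: lee_sum => q _; have [[? h] _ sub _] := hst q.
    have le1 : (lambda `](st q).1, (st q).2[%classic <= lambda (I q))%E.
      by apply: le_measure => //; rewrite inE; [exact: measurable_itv|exact: mI].
    apply: le_trans le1.
    rewrite lebesgue_measure_itv/= lte_fin; case: ifPn => //.
    by rewrite -leNgt lee_fin subr_le0.
  have -> : (\sum_(q < n) lambda (I q) = lambda (\big[setU/set0]_(q < n) I q))%E.
    by rewrite measure_bigsetU.
  apply: le_measure; rewrite ?inE//; first by apply: bigsetU_measurable => q _; exact: mI.
  by rewrite UE; exact: bigsetU_bigcup.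
Qed.

Lemma nd_acont_derive a b (G : R -> R) : a < b -> nondecreasing G ->
  (forall a' b', acont a' b' (fun s t => `|G t - G s|)) ->
  exists w : R -> R, [/\ lambda.-integrable setT (EFin \o w),
    (\int[lambda]_(x in `]a, b]) (w x)%:E = (G b - G a)%:E)%E &
    {ae lambda, forall x, a < x < b -> is_derive x 1 G (w x)}].
Proof.
move=> ab ndG H.
have cG : continuous G by exact: acont_continuous.
pose cumG : cumulative R R := HB.pack G (isCumulative.Build R _ R G ndG (right_continuousW cG)).
pose nu := lebesgue_stieltjes_measure cumG.
have mD : measurable (`]a, b] : set (measurableTypeR R)) by exact: measurable_itv.
have nuD : (nu `]a, b]%classic < +oo)%E by rewrite /nu stieltjes_itv_oc ?ltry// ltW.
(* The restriction to []a, b]] makes the Stieltjes measure finite, hence a charge. *)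
pose nuf : {finite_measure set (measurableTypeR R) -> \bar R} := mfrestr mD nuD.
pose nuc := charge_of_finite_measure nuf.
have dom : nuc `<< lambda.
  apply/null_content_dominatesP => A mA A0.
  rewrite /nuc /charge_of_finite_measure/= /mfrestr /mrestr.
  (* The margin 1 on both sides puts []a, b]], which contains [b], inside an open interval. *)
  apply: (@stieltjes_null cumG (a - 1) (b + 1)) => //.
  - by move: ab; lra.
  - exact: measurableI.
  - by apply/eqP; rewrite -measure_le0 -A0 le_measure ?inE//; exact: measurableI.
  - by move=> x [_] /=; rewrite !in_itv/= => /andP[ax xb]; apply/andP; split; move: ax xb; lra.
pose RN := Radon_Nikodym nuc lambda.
pose w x := fine (RN x).
have wE x : (w x)%:E = RN x by rewrite fineK// Radon_Nikodym_fin_num.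
have wE' : EFin \o w = RN by apply/funext => x; exact: wE.
have wint : lambda.-integrable setT (EFin \o w) by rewrite wE'; exact: Radon_Nikodym_integrable.
have intw x : a <= x <= b -> (\int[lambda]_(t in `]a, x]) (w t)%:E = (G x - G a)%:E)%E.
  move=> /andP[ax xb].
  under eq_integral do rewrite wE.
  rewrite -(@Radon_Nikodym_integral _ _ _ nuc)//.
  rewrite /nuc /charge_of_finite_measure/= /mfrestr /mrestr.
  rewrite (_ : _ `&` _ = `]a, x]%classic) ?stieltjes_itv_oc//.
  by apply/setIidPl => t /=; rewrite !in_itv/= => /andP[-> /le_trans->].
exists w; split => //.
  by apply: intw; rewrite (ltW ab) lexx.
have intwy y : lambda.-integrable [set` Interval (BRight a) (BRight y)] (EFin \o w).
  exact: (integrableS measurableT).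
have locw : locally_integrable setT w by apply: open_integrable_locally => //; exact: openT.
have := FTC1 intwy locw.
apply: filterS; first exact: (ae_filter_ringOfSetsType lambda).
move=> x /= + /andP[ax xb].
rewrite lte_fin => /(_ ax)[dF Fx].
pose F := fun y => (\int[lambda]_(t in `]a, y]) w t)%R; rewrite -/F in dF Fx.
have near_eq : \near x, G a + F x = G x.
  near=> y.
  have ay : a < y by near: y; exact: lt_nbhsr.
  have yb : y < b by near: y; exact: lt_nbhsl.
  by rewrite /F /Rintegral intw ?(ltW ay) ?ltW//= addrC subrK.
apply: (near_eq_is_derive near_eq).
have -> : w x = 0 + w x by rewrite add0r.
apply: is_deriveD.
by rewrite -Fx derive1E; exact: DeriveDef.
Unshelve. all: by end_near. Qed.

Lemma acont_derive a b (f : R -> R) : a < b -> acont a b (fun s t => `|f t - f s|) ->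
  exists w : R -> R, [/\ lambda.-integrable setT (EFin \o w),
    (\int[lambda]_(x in `]a, b]) (w x)%:E = (f b - f a)%:E)%E &
    {ae lambda, forall x, a < x < b -> is_derive x 1 f (w x)}].
Proof.
move=> ab H; pose V x := fine (total_variation a x f).
have [HV fV] := acont_fine_tv (ltW ab) H; rewrite -/V in HV fV.
(* Clamping to [[a, b]] extends [V] and [V - f] to the whole line, where a cumulative function has
   to be defined and monotone. *)
pose c (x : R) := Num.min b (Num.max a x).
have cab x : a <= c x /\ c x <= b.
  by rewrite /c le_min ge_min le_max !lexx (ltW ab).
have cE x : a <= x <= b -> c x = x.
  by move=> /andP[ax xb]; rewrite /c (max_idPr ax) (min_idPr xb).
have c_nd s t : s <= t -> c s <= c t.
  by move=> st; rewrite /c le_min !ge_min !ge_max !le_max !lexx st (ltW ab) ?orbT.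
have c_lip s t : s <= t -> c t - c s <= t - s.
  by move=> st; rewrite /c /Num.max /Num.min; case: (ltP a t) => ?; case: (ltP a s) => ?;
    do ?[case: ltP => ?]; move: ab st; lra.
have Hc D a' b' : acont a b D -> acont a' b' (fun s t => D (c s) (c t)).
  apply: (@acont_comp_nd _ _ _ _ _ 1).
  - by move=> s _; have [-> ->] := cab s.
  - by move=> s t _ st _; rewrite mul1r; split; [exact: c_nd|exact: c_lip].
have fVc s t : s <= t -> `|f (c t) - f (c s)| <= V (c t) - V (c s).
  by move=> st; apply: fV; [exact: (cab s).1|exact: c_nd|exact: (cab t).2].
have ndG1 : nondecreasing (V \o c).
  move=> s t /= st; rewrite -subr_ge0; exact: le_trans (fVc _ _ st).
have ndG2 : nondecreasing (fun x => V (c x) - f (c x)).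
  move=> s t /= st; rewrite -subr_ge0.
  by have := le_trans (ler_norm _) (fVc _ _ st); lra.
have H1 a' b' : acont a' b' (fun s t => `|(V \o c) t - (V \o c) s|).
  apply: acont_le (Hc _ a' b' HV) => s t _ st _ /=.
  by rewrite ger0_norm// (le_trans _ (fVc _ _ st)).
have H2 a' b' : acont a' b' (fun s t => `|(V (c t) - f (c t)) - (V (c s) - f (c s))|).
  apply: acont_le (Hc _ a' b' (acontD HV H)) => s t _ st _ /=.
  have h := fVc _ _ st; have h0 := le_trans (normr_ge0 _) h.
  rewrite (_ : V (c t) - f (c t) - (V (c s) - f (c s)) =
    (V (c t) - V (c s)) - (f (c t) - f (c s))); last by lra.
  by rewrite (le_trans (ler_normB _ _))// ger0_norm.
have [w1 [iw1 Iw1 dw1]] := nd_acont_derive ab ndG1 H1.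
have [w2 [iw2 Iw2 dw2]] := nd_acont_derive ab ndG2 H2.
exists (fun x => w1 x - w2 x); split.
- rewrite (_ : EFin \o _ = (EFin \o w1) \- (EFin \o w2))%E; last by apply/funext => x.
  exact: integrableB.
- under eq_integral do rewrite EFinB.
  rewrite integralB//; [|exact: (integrableS measurableT)..].
  rewrite Iw1 Iw2 -EFinB /= !cE ?lexx ?(ltW ab)//; congr _%:E; lra.
- apply: filterS2 dw1 dw2; first exact: (ae_filter_ringOfSetsType lambda).
  move=> x h1 h2 axb; have {}h1 := h1 axb; have {}h2 := h2 axb.
  have near_eq : \near x, ((V \o c) - (fun x => V (c x) - f (c x))) x = f x.
    near=> y.
    have ay : a < y by near: y; apply: lt_nbhsr; case/andP: axb.
    have yb : y < b by near: y; apply: lt_nbhsl; case/andP: axb.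
    by rewrite /= opprB addrC subrK cE// (ltW ay) ltW.
  exact: (near_eq_is_derive near_eq).
Unshelve. all: by end_near. Qed.

End StieltjesAC.


(** * Integrals of possibly nonmeasurable functions *)

(* The library integral of a nonnegative function is the supremum of the
   integrals of the simple functions below it, hence a lower integral when the
   function is not measurable.  The integrand in [curve_length] need not be
   Borel, so measurability is not assumed of the integrands below. *)
Section LowerIntegral.
Import HBNNSimple.
Context d (T : measurableType d) (R : realType).
Variable mu : {measure set T -> \bar R}.
Local Open Scope ereal_scope.
Implicit Types (f g : T -> \bar R) (D : set T).

Lemma le_lower_integral D f g : (forall x, D x -> 0 <= f x) ->
  (forall x, D x -> f x <= g x) -> \int[mu]_(x in D) f x <= \int[mu]_(x in D) g x.
Proof.
move=> f0 fg; have g0 x (Dx : D x) : 0 <= g x by rewrite (le_trans (f0 _ Dx))// fg.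
rewrite !ge0_integralE//; apply: le_ereal_sup => _ [h hf <-]; exists h => // x.
by rewrite (le_trans (hf x))// lee_restrict.
Qed.

Lemma lower_integral_subset D D' f : D `<=` D' -> (forall x, D' x -> 0 <= f x) ->
  \int[mu]_(x in D) f x <= \int[mu]_(x in D') f x.
Proof.
move=> DD' f0; rewrite integral_mkcond [leRHS]integral_mkcond.
apply: le_lower_integral => x _; first by apply: erestrict_ge0 => y /DD'/f0.
rewrite !patchE; case: ifPn => [/set_mem/DD' D'x|_]; first by rewrite mem_set.
by case: ifPn => // /set_mem/f0.
Qed.

(** Reduces an upper bound on a lower integral to measurable minorants vanishing off [D], to which
    measurable integration theory applies. *)
Lemma lower_integral_le D f M : (forall x, D x -> 0 <= f x) ->
  (forall h : T -> R, measurable_fun setT h -> (forall x, (0 <= h x)%R) ->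
     (forall x, D x -> (h x)%:E <= f x) -> (forall x, ~ D x -> h x = 0%R) ->
     \int[mu]_x (h x)%:E <= M) ->
  \int[mu]_(x in D) f x <= M.
Proof.
move=> f0 H; rewrite ge0_integralE//; apply: ge_ereal_sup => _ [h hf <-].
rewrite -integralT_nnsfun; apply: H => //.
- by move=> x Dx; have := hf x; rewrite patchE mem_set.
- move=> x Dx; apply/eqP; rewrite eq_le fun_ge0 andbT -lee_fin.
  by have := hf x; rewrite patchE memNset.
Qed.

Lemma lower_integral_setU A B D f : measurable A -> measurable B -> D `<=` A `|` B ->
  (forall x, (A `|` B) x -> 0 <= f x) ->
  \int[mu]_(x in D) f x <= \int[mu]_(x in A) f x + \int[mu]_(x in B) f x.
Proof.
move=> mA mB DAB f0; apply: lower_integral_le => [x /DAB/f0//|h mh h0 hf hD].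
have mhE : measurable_fun setT (EFin \o h) by exact/measurable_EFinP.
rewrite -(setUv A) ge0_integral_setU//=; last 4 first.
- exact: measurableC.
- by rewrite setUv.
- by move=> x _; rewrite lee_fin.
- exact/disj_setPCl.
have hle x : (A `|` B) x -> (h x)%:E <= f x.
  move=> ABx; have [Dx|Dx] := pselect (D x); first exact: hf.
  by rewrite hD// f0.
apply: leeD.
  by apply: le_lower_integral => x Ax; [rewrite lee_fin|apply: hle; left].
rewrite integral_mkcond [leRHS]integral_mkcond; apply: le_lower_integral => x _.
  by apply: erestrict_ge0 => *; rewrite lee_fin.
rewrite !patchE; case: ifPn => [/set_mem Ax|_].
  case: ifPn => [/set_mem Bx|/negP Bx]; first by apply: hle; right.
  by rewrite hD// => /DAB[//|Bx']; apply: Bx; rewrite inE.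
by case: ifPn => // /set_mem Bx; apply: f0; right.
Qed.

Lemma lower_integral_null N f : measurable N -> mu N = 0 ->
  (forall x, N x -> 0 <= f x) -> \int[mu]_(x in N) f x = 0.
Proof.
move=> mN N0 f0; apply/eqP; rewrite eq_le integral_ge0// andbT.
apply: lower_integral_le => // h mh h0 hf hN.
rewrite (_ : (fun x => _) = (EFin \o h) \_ N); last first.
  by apply/funext => x; rewrite patchE; case: ifPn => // /negP Nx; rewrite hN// => Nx'; apply: Nx; rewrite inE.
have mhE : measurable_fun N (EFin \o h).
  by apply: measurable_funS measurableT (@subsetT _ _) _; exact/measurable_EFinP.
rewrite -integral_mkcond (@ge0_negligible_integral _ _ _ mu N N)//.
- by rewrite setDv integral_set0.
- by move=> x _; rewrite lee_fin.
Qed.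

Lemma lower_integral_setD_null N D f : measurable N -> mu N = 0 -> measurable D ->
  (forall x, D x -> 0 <= f x) ->
  \int[mu]_(x in D) f x = \int[mu]_(x in D `\` N) f x.
Proof.
move=> mN N0 mD f0; apply/eqP; rewrite eq_le; apply/andP; split; last first.
  by apply: lower_integral_subset => // x [].
apply: le_trans (lower_integral_setU (A := D `\` N) (B := D `&` N) _ _ _ _) _.
- exact: measurableD.
- exact: measurableI.
- by move=> x Dx; have [?|?] := pselect (N x); [right|left].
- by move=> x [] [] // *; exact: f0.
rewrite (@lower_integral_null (D `&` N)) ?adde0//.
- exact: measurableI.
- by apply/eqP; rewrite -measure_le0 -N0 le_measure ?inE//; exact: measurableI.
- by move=> x [] *; exact: f0.
Qed.

End LowerIntegral.

(** * Affine substitution in integrals *)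

Section AffineChange.
Context {R : realType}.
Local Notation lambda := (@lebesgue_measure R).
Local Open Scope ereal_scope.

(** The image of the Lebesgue measure under [psi], divided by [|a|], gives intervals their length,
    so uniqueness of the Lebesgue measure applies. *)
Lemma ge0_integral_affine (a c : R) (h : R -> R) : a != 0%R ->
  measurable_fun (setT : set (measurableTypeR R)) h -> (forall x, (0 <= h x)%R) ->
  \int[lambda]_t (h t)%:E = \int[lambda]_s (`|a|^-1 * h ((s - c) / a))%:E.
Proof.
move=> a0 mh h0.
pose psi (s : measurableTypeR R) : measurableTypeR R := ((s - c) / a)%R.
have mpsi : measurable_fun setT psi.
  rewrite -[measurable_fun _ _]/(measurable_fun setT (fun s : R => ((s - c) / a)%R)).
  by apply: measurable_funM => //; exact: measurable_funB.
have na0 : (0 < `|a|)%R by rewrite normr_gt0.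
have ia0 : (0 <= `|a|^-1)%R by rewrite invr_ge0.
pose P : {measure set (measurableTypeR R) -> \bar R} :=
  measure_function_pushforward__canonical__measure_function_Measure lambda mpsi.
pose nu : {measure set (measurableTypeR R) -> \bar R} := mscale (NngNum ia0) P.
have nuE A : measurable A -> lambda A = nu A.
  apply: lebesgue_measure_unique => X [[x y] _ /= <-].
  rewrite /nu /mscale/= /pushforward.
  have [ap|an] := ltP 0%R a.
    have -> : psi @^-1` `]x, y] = `](a * x + c)%R, (a * y + c)%R]%classic.
      apply/seteqP; split => s /=; rewrite !in_itv/= /psi ltr_pdivlMr// ler_pdivrMr//;
      by rewrite ltrBrDr lerBlDr ![(_ * a)%R]mulrC.
    rewrite !lebesgue_measure_itv/= !lte_fin ltrD2r ltr_pM2l//.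
    case: ifPn => _; last by rewrite mule0.
    rewrite -EFinB -EFinM; congr _%:E; rewrite gtr0_norm//; field.
    by rewrite gt_eqF.
  have {}an : (a < 0)%R by rewrite lt_neqAle a0 an.
  (* For negative [a] the preimage is closed on the left and open on the right, which does not
     affect its length. *)
  have -> : psi @^-1` `]x, y] = `[(a * y + c)%R, (a * x + c)%R[%classic.
    apply/seteqP; split => s /=; rewrite !in_itv/= /psi ltr_ndivlMr// ler_ndivrMr//;
    by rewrite ltrBlDr lerBrDr ![(_ * a)%R]mulrC andbC.
  rewrite !lebesgue_measure_itv/= !lte_fin ltrD2r ltr_nM2l//.
  case: ifPn => _; last by rewrite mule0.
  rewrite -EFinB -EFinM; congr _%:E; rewrite ltr0_norm//; field.
  by rewrite lt_eqF.
have mhE : measurable_fun setT (EFin \o h) by exact/measurable_EFinP.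
rewrite (@eq_measure_integral _ _ _ _ nu); last by move=> A mA _; exact: nuE.
rewrite ge0_integral_mscale//; last by move=> x _; rewrite lee_fin.
rewrite ge0_integral_pushforward//=; last by move=> x _; rewrite lee_fin.
rewrite preimage_setT -ge0_integralZl//.
- by apply/measurable_EFinP; exact: (measurableT_comp mh mpsi).
- by move=> x _; rewrite lee_fin.
Qed.

(** The substitution is performed on a measurable minorant of [g], which it carries to a minorant of
    [f] on [E]. *)
Lemma lower_integral_affine (a c : R) (D E : set R) (f g : R -> \bar R) : a != 0%R ->
  (forall t, D t -> 0 <= g t) -> (forall s, E s -> 0 <= f s) ->
  (forall t, D t -> E (a * t + c)%R) ->
  (forall t, D t -> g t <= `|a|%:E * f (a * t + c)%R) ->
  \int[lambda]_(t in D) g t <= \int[lambda]_(s in E) f s.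
Proof.
move=> a0 g0 f0 DE gf; apply: lower_integral_le => // h mh h0 hg hD.
rewrite (ge0_integral_affine c a0)// [leRHS]integral_mkcond.
have na0 : (0 < `|a|)%R by rewrite normr_gt0.
apply: le_lower_integral => s _; first by rewrite lee_fin mulr_ge0// invr_ge0.
have sE : s = (a * ((s - c) / a) + c)%R by rewrite mulrC divfK// subrK.
have [Dt|Dt] := pselect (D ((s - c) / a)%R); last first.
  by rewrite hD// mulr0; exact: erestrict_ge0.
have Es : E s by rewrite sE; exact: DE.
rewrite patchE mem_set// EFinM lee_pdivrMl//.
by apply: le_trans (hg _ Dt) _; apply: le_trans (gf _ Dt) _; rewrite -sE.
Qed.

End AffineChange.

(** * Lengths of curves and the path distance *)

Section EuclideanNorm.
Context {R : realType} {n : nat}.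
Implicit Types (u v : 'rV[R]_n) (A : 'M[R]_n).

Lemma enorm_ge0 v : 0 <= enorm v.
Proof. exact: sqrtr_ge0. Qed.

Lemma enorm_sqr v : enorm v ^+ 2 = \sum_(i < n) v 0 i ^+ 2.
Proof. by rewrite sqr_sqrtr// sumr_ge0// => i _; exact: sqr_ge0. Qed.

Lemma enorm0 : enorm (0 : 'rV[R]_n) = 0.
Proof.
by apply/eqP; rewrite -(sqrf_eq0 (enorm _)) enorm_sqr big1// => i _; rewrite mxE expr0n.
Qed.

Lemma enormZ (a : R) v : enorm (a *: v) = `|a| * enorm v.
Proof.
apply/eqP; rewrite -(@eqrXn2 _ 2)//; last 2 first.
- exact: enorm_ge0.
- by rewrite mulr_ge0// enorm_ge0.
rewrite exprMn !enorm_sqr real_normK ?num_real// mulr_sumr.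
by apply/eqP/eq_bigr => i _; rewrite mxE exprMn.
Qed.

Lemma enormN v : enorm (- v) = enorm v.
Proof. by rewrite -scaleN1r enormZ normrN1 mul1r. Qed.

Lemma enorm_distC u v : enorm (u - v) = enorm (v - u).
Proof. by rewrite -enormN opprB. Qed.

Lemma coord_le_enorm v i : `|v 0 i| <= enorm v.
Proof.
rewrite -(@ler_pXn2r _ 2)// ?nnegrE ?enorm_ge0//.
rewrite enorm_sqr real_normK ?num_real// (bigD1 i)//= lerDl sumr_ge0// => j _.
exact: sqr_ge0.
Qed.

(** The Cauchy-Schwarz inequality: the squared norm of [enorm v ^+ 2 *: u - C *: v] is nonnegative,
    where [C] is the scalar product. *)
Lemma enorm_dot u v : \sum_(i < n) u 0 i * v 0 i <= enorm u * enorm v.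
Proof.
set C := \sum_(i < n) _.
have [v0|v0] := eqVneq v 0.
  by rewrite /C v0 enorm0 mulr0 big1// => i _; rewrite mxE mulr0.
have B0 : 0 < enorm v ^+ 2.
  rewrite exprn_gt0// lt_neqAle enorm_ge0 andbT eq_sym; apply: contra v0 => /eqP v0.
  apply/eqP/rowP => i; rewrite mxE; apply/eqP; rewrite -normr_eq0 eq_le normr_ge0 andbT.
  by rewrite -v0 coord_le_enorm.
have : 0 <= \sum_(i < n) (enorm v ^+ 2 * u 0 i - C * v 0 i) ^+ 2.
  by apply: sumr_ge0 => i _; exact: sqr_ge0.
have -> : \sum_(i < n) (enorm v ^+ 2 * u 0 i - C * v 0 i) ^+ 2 =
    enorm v ^+ 2 * (enorm v ^+ 2 * enorm u ^+ 2 - C ^+ 2).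
  rewrite (eq_bigr (fun i => (enorm v ^+ 2) ^+ 2 * u 0 i ^+ 2 -
    2 * enorm v ^+ 2 * C * (u 0 i * v 0 i) + C ^+ 2 * v 0 i ^+ 2)); last by move=> i _; ring.
  rewrite big_split/= sumrB -!mulr_sumr -!enorm_sqr -/C; ring.
rewrite pmulr_rge0// subr_ge0 -exprMn mulrC => h.
apply: le_trans (ler_norm _) _.
rewrite -(@ler_pXn2r _ 2)// ?nnegrE ?mulr_ge0 ?enorm_ge0//.
by rewrite real_normK// num_real.
Qed.

Lemma enormD u v : enorm (u + v) <= enorm u + enorm v.
Proof.
rewrite -(@ler_pXn2r _ 2)// ?nnegrE ?addr_ge0 ?enorm_ge0//.
rewrite sqrrD !enorm_sqr.
rewrite (eq_bigr (fun i => u 0 i ^+ 2 + 2 * (u 0 i * v 0 i) + v 0 i ^+ 2)); last by move=> i _; rewrite mxE; ring.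
rewrite !big_split/= -mulr_sumr lerD2r lerD2l mulr_natl lerMn2r/=.
exact: enorm_dot.
Qed.

(** A crude substitute for the square root of [n]; the factor is at least 1 in every dimension,
    which keeps the upper Lipschitz constant above the lower one. *)
Lemma enorm_le_norm v : enorm v <= n.+1%:R * `|v|.
Proof.
rewrite -(@ler_pXn2r _ 2)// ?nnegrE ?mulr_ge0 ?enorm_ge0//.
rewrite enorm_sqr.
have h i : v 0 i ^+ 2 <= `|v| ^+ 2.
  rewrite -[v 0 i ^+ 2]real_normK ?num_real// ler_pXn2r ?nnegrE//.
  by rewrite [leRHS]mx_normrE (le_bigmax _ _ (0, i)).
apply: le_trans (_ : \sum_(i < n) `|v| ^+ 2 <= _); first exact: ler_sum.
rewrite sumr_const card_ord exprMn -[leLHS]mulr_natl ler_wpM2r ?sqr_ge0//.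
rewrite -natrX ler_nat; apply: leq_trans (leqnSn _) _.
by rewrite -[X in (X <= _)%N]expn1 leq_pexp2l.
Qed.

Lemma norm_le_coord v (e : R) : 0 <= e -> (forall i, `|v 0 i| <= e) -> `|v| <= e.
Proof.
move=> e0 h; rewrite [leLHS]mx_normrE; apply: bigmax_le => // -[i j] _ /=.
by rewrite ord1.
Qed.

Lemma quadZ A (a : R) v : quad A (a *: v) = a ^+ 2 * quad A v.
Proof. by rewrite /quad linearZ/= -!scalemxAl -scalemxAr scalerA mxE expr2. Qed.

End EuclideanNorm.

(** * Derivatives and lengths of absolutely continuous curves *)

Section CurveLength.
Context {R : realType} {n : nat}.
Implicit Types (gam : R -> 'rV[R]_n) (g : 'rV[R]_n -> 'M[R]_n) (a b c : R).
Local Notation lambda := (@lebesgue_measure R).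

Lemma derive1_rowE gam t : derivable gam t 1 ->
  derive1 gam t = \row_j derive1 (fun x => gam x 0 j) t.
Proof.
move=> dg; rewrite derive1E derive_mx//; apply/rowP => j; rewrite !mxE.
by rewrite derive1E.
Qed.

Lemma derive1_affine gam a c t : derivable gam (a * t + c) 1 ->
  derivable (fun x => gam (a * x + c)) t 1 /\
  derive1 (fun x => gam (a * x + c)) t = a *: derive1 gam (a * t + c).
Proof.
move=> dg.
have H j : is_derive t 1 (fun x => gam (a * x + c) 0 j)
    (derive1 (fun x => gam x 0 j) (a * t + c) * a).
  apply: (@is_derive1_comp _ (fun x => gam x 0 j) (fun x => a * x + c)).
    by rewrite derive1E; apply: DeriveDef => //; move/derivable_mxP : dg; exact.
  have -> : a = a * 1 + 0 by rewrite mulr1 addr0.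
  have -> : (fun x => (a * 1 + 0) * x + c) = (a *: (id : R -> R)) + cst c.
    by apply/funext => x; rewrite mulr1 addr0.
  rewrite mulr1 addr0 -[X in is_derive _ _ _ X]addr0 -[X in X + 0]mulr1.
  exact: is_deriveD.
have dga : derivable (fun x => gam (a * x + c)) t 1.
  by apply/derivable_mxP => i j; rewrite (ord1 i); exact: ex_derive.
split=> //; rewrite !derive1_rowE//; apply/rowP => j; rewrite !mxE.
by rewrite mulrC derive1E; exact: derive_val.
Qed.

(** Each coordinate increment is bounded by [enorm], so the scalar theorem applies to every
    coordinate; the finitely many exceptional null sets are merged. *)
Lemma absolutely_continuous_derive a b gam : a < b -> absolutely_continuous a b gam ->
  exists w : R -> 'rV[R]_n, [/\ forall i, lambda.-integrable setT (EFin \o (fun t => w t 0 i)),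
    forall i, (\int[lambda]_(t in `]a, b]) (w t 0 i)%:E = (gam b 0 i - gam a 0 i)%:E)%E &
    {ae lambda, forall t, a < t < b -> derivable gam t 1 /\ derive1 gam t = w t}].
Proof.
move=> ab /absolutely_continuousE AC.
have H i : exists w : R -> R, [/\ lambda.-integrable setT (EFin \o w),
    (\int[lambda]_(x in `]a, b]) (w x)%:E = (gam b 0 i - gam a 0 i)%:E)%E &
    {ae lambda, forall x, a < x < b -> is_derive x 1 (fun t => gam t 0 i) (w x)}].
  apply: acont_derive => //; apply: acont_le AC => s t _ _ _.
  have -> : gam t 0 i - gam s 0 i = (gam t - gam s) 0 i by rewrite !mxE.
  exact: coord_le_enorm.
have [w hw] := choice H.
exists (fun t => \row_i w i t).
have wE i : (fun t => (\row_i w i t) 0 i) = w i by apply/funext => t; rewrite mxE.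
split=> [i|i|].
- by rewrite wE; have [] := hw i.
- by under eq_integral do rewrite mxE; have [] := hw i.
have : {ae lambda, forall t, forall i, a < t < b -> is_derive t 1 (fun t => gam t 0 i) (w i t)}.
  apply: filter_forall => i.
  by have [] := hw i.
apply: filterS; first exact: (ae_filter_ringOfSetsType lambda).
move=> t h tab.
have dg : derivable gam t 1.
  apply/derivable_mxP => i j; rewrite (ord1 i); have ? := h j tab; exact: ex_derive.
split=> //; rewrite derive1_rowE//; apply/rowP => j; rewrite !mxE derive1E.
have ? := h j tab; exact: derive_val.
Qed.

Lemma absolutely_continuous_derivable a b gam : a < b -> absolutely_continuous a b gam ->
  exists N : set R, [/\ measurable N, lambda N = 0%E &
    forall t, a < t < b -> ~ N t -> derivable gam t 1].
Proof.
move=> ab /absolutely_continuous_derive-/(_ ab)[w [_ _ [N [mN N0 sub]]]].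
exists N; split => // t tab Nt; apply: contra_notP Nt => dg.
by apply: sub => /= /(_ tab)[].
Qed.

(** The increment of the coordinate is the integral of [w t 0 i], and the speed is at least [c]
    times [|w t 0 i|] almost everywhere. *)
Lemma curve_length_lower g gam c i : 0 <= c -> absolutely_continuous 0 1 gam ->
  (forall t, 0 <= t <= 1 -> forall v, c ^+ 2 * enorm v ^+ 2 <= quad (g (gam t)) v) ->
  ((c * `|gam 1 0 i - gam 0 0 i|)%:E <= curve_length g `[0%R, 1%R] gam)%E.
Proof.
move=> c0 AC cg.
have [w [iw intw [N [mN N0 sub]]]] := absolutely_continuous_derive ltr01 AC.
have mw : measurable_fun (`]0, 1]%classic : set (measurableTypeR R)) (EFin \o (fun t => w t 0 i)).
  by apply: measurable_funTS; exact: measurable_int (iw i).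
(* The endpoint 1 joins the null set because the derivative is known only on the open interval. *)
have mN1 : measurable (N `|` [set 1] : set (measurableTypeR R)).
  by apply: measurableU => //; exact: measurable_set1.
have N10 : lambda (N `|` [set 1]) = 0%E.
  have h : (lambda (N `|` [set 1%R]) <= lambda N + lambda [set 1%R])%E.
    by apply: measureU2 => //; exact: measurable_set1.
  apply/eqP; rewrite -measure_le0; apply: le_trans h _.
  by rewrite N0 add0e [leLHS]lebesgue_measure_set1.
apply: (@le_trans _ _ (\int[lambda]_(t in `]0%R, 1%R]) (c * `|w t 0%R i|)%R%:E)%E).
  under eq_integral do rewrite EFinM.
  rewrite ge0_integralZl//; last first.
    by apply/measurable_EFinP; apply: measurableT_comp => //; exact/measurable_EFinP.
  rewrite EFinM lee_wpmul2l ?lee_fin//.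
  have := le_abse_integral lambda (measurable_itv `]0, 1]) mw.
  by rewrite [X in `|X|%E]intw.
rewrite (@lower_integral_setD_null _ _ _ lambda (N `|` [set 1]))//; last first.
  by move=> x _; rewrite lee_fin mulr_ge0.
apply: (@le_trans _ _ (\int[lambda]_(t in `]0%R, 1%R] `\` (N `|` [set 1%R]))
    (Num.sqrt (quad (g (gam t)) (derive1 gam t)))%:E)%E); last first.
  apply: lower_integral_subset => [t []|t _]; last by rewrite lee_fin sqrtr_ge0.
  by rewrite /= !in_itv/= => /andP[/ltW -> ->].
apply: le_lower_integral => t; first by rewrite lee_fin mulr_ge0.
move=> [/= + /not_orP[Nt t1]]; rewrite in_itv/= => /andP[t0 t1'].
have t01 : 0 < t < 1.
  by rewrite t0 lt_neqAle t1' andbT; apply/eqP.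
have -> : derive1 gam t = w t.
  by apply: contra_notP Nt => dg; apply: sub => /= /(_ t01)[].
rewrite lee_fin.
apply: le_trans (_ : Num.sqrt (c ^+ 2 * enorm (w t) ^+ 2) <= _).
  rewrite -exprMn sqrtr_sqr; apply: le_trans (ler_norm _).
  by rewrite ler_wpM2l// coord_le_enorm.
by rewrite ler_wsqrtr// cg// (ltW t0).
Qed.

(** Agreement is asked only near each point of [D], so that each half of a concatenation
    qualifies. *)
Lemma curve_length_affine g gam gam' a c (D E : set R) : a != 0 ->
  (forall t, D t -> [/\ E (a * t + c), derivable gam (a * t + c) 1 &
     \forall x \near t, gam' x = gam (a * x + c)]) ->
  (curve_length g D gam' <= curve_length g E gam)%E.
Proof.
move=> a0 H; apply: (@lower_integral_affine _ a c) => //.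
- by move=> t /H[].
move=> t /H[Et dg near_eq].
have -> : derive1 gam' t = a *: derive1 gam (a * t + c).
  by rewrite derive1E (near_eq_derive _ near_eq) -derive1E (derive1_affine dg).2.
rewrite (nbhs_singleton near_eq) quadZ -EFinM lee_fin sqrtrM ?sqr_ge0//.
by rewrite sqrtr_sqr.
Qed.

(** The measure of the preimage is the integral of 1, and the affine substitution bounds it by a
    constant integrated over the null set [N]. *)
Lemma affine_preimage_null a c (N : set R) : a != 0 -> measurable N -> lambda N = 0%E ->
  measurable ((fun t => a * t + c) @^-1` N) /\ lambda ((fun t => a * t + c) @^-1` N) = 0%E.
Proof.
move=> a0 mN N0; set N' := _ @^-1` _.
have mN' : measurable N'.
  rewrite -[N']setTI; apply: (_ : measurable_fun setT (fun t : R => a * t + c)) => //.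
  by apply: measurable_funD => //; exact: measurable_funM.
split=> //; apply/eqP; rewrite -measure_le0.
apply: (@le_trans _ _ (\int[lambda]_(x in N') 1%:E)%E).
  by rewrite integral_cst// mul1e.
apply: (@le_trans _ _ (\int[lambda]_(x in N) (`|a|^-1)%:E)%E); last first.
  by rewrite lower_integral_null// => t _; rewrite lee_fin invr_ge0.
apply: (@lower_integral_affine _ a c) => // t _.
by rewrite -EFinM mulfV// normr_eq0.
Qed.

End CurveLength.

(** * Symmetry, triangle inequality and norm bounds for the path distance *)

Section PathDistance.
Context {R : realType} {n : nat}.
Implicit Types (gam : R -> 'rV[R]_n) (g : 'rV[R]_n -> 'M[R]_n) (D : set 'rV[R]_n).
Local Notation lambda := (@lebesgue_measure R).

Lemma null_setU2 (A B : set R) : measurable A -> measurable B ->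
  lambda A = 0%E -> lambda B = 0%E -> measurable (A `|` B) /\ lambda (A `|` B) = 0%E.
Proof.
move=> mA mB A0 B0; split; first exact: measurableU.
have h : (lambda (A `|` B) <= lambda A + lambda B)%E by exact: measureU2.
by apply/eqP; rewrite -measure_le0; apply: le_trans h _; rewrite A0 B0 adde0.
Qed.

Lemma curve_length_setD_null g gam (N I : set R) : measurable N -> lambda N = 0%E ->
  measurable I -> curve_length g I gam = curve_length g (I `\` N) gam.
Proof. by move=> mN N0 mI; exact: lower_integral_setD_null. Qed.

Lemma absolutely_continuous_reverse gam : absolutely_continuous 0 1 gam ->
  absolutely_continuous 0 1 (fun t => gam (1 - t)).
Proof.
move=> /absolutely_continuousE/acont_comp_ni; rewrite oppr0 => H.
apply/absolutely_continuousE.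
have : acont 0 1 (fun s t : R => enorm (gam (- (s - 1)) - gam (- (t - 1)))).
  apply: (acont_comp_nd (K := 1) (phi := fun t => t - 1)) H => [s|s t _ st _].
    by move=> /andP[? ?]; rewrite lerBrDr addNr lerBlDr add0r; apply/andP.
  by rewrite lerD2r mul1r opprB addrA subrK.
by apply: acont_le => s t _ _ _; rewrite !opprB enorm_distC.
Qed.

(** One inequality gives the symmetry of the infimum, since it is applied with both orders of the
    endpoints. *)
Lemma curve_length_reverse g gam : absolutely_continuous 0 1 gam ->
  (curve_length g `[0%R, 1%R] (fun t => gam (1 - t)%R) <= curve_length g `[0%R, 1%R] gam)%E.
Proof.
move=> AC; have [N [mN N0 dN]] := absolutely_continuous_derivable ltr01 AC.
have N1 : (-1 : R) != 0 by rewrite oppr_eq0.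
have [mN' N'0] := affine_preimage_null 1 N1 mN N0.
have [m1 n1] := null_setU2 mN' (measurable_set1 0) N'0 (lebesgue_measure_set1 0).
have [m2 n2] := null_setU2 m1 (measurable_set1 1) n1 (lebesgue_measure_set1 1).
rewrite [leLHS](curve_length_setD_null _ _ m2 n2 (measurable_itv _)).
apply: (curve_length_affine (c := 1) _ N1) => t [/=].
rewrite in_itv/= => /andP[t0 t1] /not_orP[/not_orP[Nt /eqP t0'] /eqP t1'].
have {}t0 : 0 < t by rewrite lt_neqAle eq_sym t0'.
have {}t1 : t < 1 by rewrite lt_neqAle t1'.
split.
- by rewrite in_itv/=; apply/andP; split; move: t0 t1; lra.
- by apply: dN => //; apply/andP; split; move: t0 t1; lra.
- by near=> x; rewrite mulN1r addrC.
Unshelve. all: by end_near. Qed.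

(* This form makes absolute continuity of the concatenation a consequence of
   its stability under sums and monotone Lipschitz reparametrizations. *)
Definition curve_concat gam1 gam2 : R -> 'rV[R]_n :=
  fun t => gam1 (Num.min (2 * t) 1) + gam2 (Num.max (2 * t - 1) 0) - gam2 0.

Lemma curve_concatl gam1 gam2 t : t <= 2^-1 -> curve_concat gam1 gam2 t = gam1 (2 * t).
Proof.
move=> t2; rewrite /curve_concat (min_idPl _); last by move: t2; lra.
by rewrite (max_idPr _) ?addrK//; move: t2; lra.
Qed.

Lemma curve_concatr gam1 gam2 t : gam1 1 = gam2 0 -> 2^-1 <= t ->
  curve_concat gam1 gam2 t = gam2 (2 * t - 1).
Proof.
move=> g12 t2; rewrite /curve_concat (min_idPr _); last by move: t2; lra.
by rewrite (max_idPl _) ?g12 1?addrC ?addrK//; [rewrite addrA addNr add0r|move: t2; lra].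
Qed.

Lemma absolutely_continuous_concat gam1 gam2 :
  absolutely_continuous 0 1 gam1 -> absolutely_continuous 0 1 gam2 ->
  absolutely_continuous 0 1 (curve_concat gam1 gam2).
Proof.
move=> /absolutely_continuousE H1 /absolutely_continuousE H2; apply/absolutely_continuousE.
have K1 : acont 0 1 (fun s t : R =>
    enorm (gam1 (Num.min (2 * t) 1) - gam1 (Num.min (2 * s) 1))).
  apply: (acont_comp_nd (K := 2) (phi := fun t => Num.min (2 * t) 1)) H1 => [s|s t _ st _].
    by move=> /andP[? ?]; rewrite le_min ge_min lexx ler01 orbT !andbT mulr_ge0.
  split; first by rewrite le_min !ge_min lexx orbT andbT ler_pM2l ?st.
  by rewrite /Num.min; do 2 case: ltP => ?; move: st; lra.
have K2 : acont 0 1 (fun s t : R =>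
    enorm (gam2 (Num.max (2 * t - 1) 0) - gam2 (Num.max (2 * s - 1) 0))).
  apply: (acont_comp_nd (K := 2) (phi := fun t => Num.max (2 * t - 1) 0)) H2 => [s|s t _ st _].
    by move=> /andP[? ?]; rewrite ge_max le_max lexx ler01 orbT andbT/=; lra.
  split; first by rewrite ge_max !le_max lexx orbT andbT lerD2r ler_pM2l ?st.
  by rewrite /Num.max; do 2 case: ltP => ?; move: st; lra.
apply: acont_le (acontD K1 K2) => s t _ _ _.
rewrite /curve_concat; apply: le_trans (enormD _ _); rewrite le_eqVlt; apply/orP; left.
apply/eqP; congr enorm; rewrite opprB addrA subrK opprD !addrA; congr (_ - _).
by rewrite addrAC.
Qed.

Lemma curve_length_concat g gam1 gam2 : gam1 1 = gam2 0 ->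
  absolutely_continuous 0 1 gam1 -> absolutely_continuous 0 1 gam2 ->
  (curve_length g `[0%R, 1%R] (curve_concat gam1 gam2) <=
   curve_length g `[0%R, 1%R] gam1 + curve_length g `[0%R, 1%R] gam2)%E.
Proof.
move=> g12 AC1 AC2.
have [N1 [mN1 N10 dN1]] := absolutely_continuous_derivable ltr01 AC1.
have [N2 [mN2 N20 dN2]] := absolutely_continuous_derivable ltr01 AC2.
have two0 : (2 : R) != 0 by [].
have [mP1 P10] := affine_preimage_null 0 two0 mN1 N10.
have [mP2 P20] := affine_preimage_null (-1) two0 mN2 N20.
have [m1 n1] := null_setU2 mP1 (measurable_set1 0) P10 (lebesgue_measure_set1 0).
have [m2 n2] := null_setU2 mP2 (measurable_set1 1) P20 (lebesgue_measure_set1 1).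
have [m3 n3] := null_setU2 m1 m2 n1 n2.
(* The junction time joins the null set: the two one-sided derivatives there may differ. *)
have [m4 n4] := null_setU2 m3 (measurable_set1 2^-1) n3 (lebesgue_measure_set1 2^-1).
rewrite (curve_length_setD_null _ _ m4 n4)//.
set S1 := _ `|` [set 0] in m1 n1 m3 m4 n3 n4 *; set S2 := _ `|` [set 1] in m2 n2 m3 m4 n3 n4 *.
have mA : measurable (`]0, 2^-1[%classic `\` S1) by apply: measurableD.
have mB : measurable (`]2^-1, 1[%classic `\` S2) by apply: measurableD.
apply: le_trans (@lower_integral_setU _ _ _ lambda _ _ _ _ mA mB _ _) _.
- move=> t [/=]; rewrite in_itv/= => /andP[t0 t1] /not_orP[/not_orP[nS1 nS2] /eqP th].
  have [tl|tr] := ltP t 2^-1; [left|right]; split => //=; rewrite in_itv/= ?tl ?andbT.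
    by rewrite lt_neqAle t0 andbT; apply/eqP => E; apply: nS1; right.
  rewrite lt_neqAle eq_sym th tr/= lt_neqAle t1 andbT; apply/eqP => E; apply: nS2; right.
  exact: E.
- by move=> t _; rewrite lee_fin sqrtr_ge0.
apply: leeD.
- apply: (curve_length_affine (c := 0) _ two0) => t [/=].
  rewrite in_itv/= => /andP[t0 t1] /not_orP[nN _]; split.
  + by rewrite in_itv/= addr0; apply/andP; split; move: t0 t1; lra.
  + by apply: dN1 => //; rewrite addr0; apply/andP; split; move: t0 t1; lra.
  + near=> x; rewrite addr0; apply: curve_concatl; apply: ltW.
    by near: x; exact: lt_nbhsl.
- apply: (curve_length_affine (c := -1) _ two0) => t [/=].
  rewrite in_itv/= => /andP[t0 t1] /not_orP[nN _]; split.
  + by rewrite in_itv/=; apply/andP; split; move: t0 t1; lra.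
  + by apply: dN2 => //; apply/andP; split; move: t0 t1; lra.
  + near=> x; apply: curve_concatr => //; apply: ltW.
    by near: x; exact: lt_nbhsr.
Unshelve. all: by end_near. Qed.

Definition segment (p q : 'rV[R]_n) : R -> 'rV[R]_n := fun t => p + t *: (q - p).

Lemma absolutely_continuous_segment p q a b : absolutely_continuous a b (segment p q).
Proof.
apply/absolutely_continuousE => e e0.
have K0 : 0 < enorm (q - p) + 1 by rewrite ltr_wpDl// enorm_ge0.
exists (e / (enorm (q - p) + 1)); first by rewrite divr_gt0.
move=> I s t st _; rewrite ltr_pdivlMr//; apply: le_lt_trans.
rewrite mulr_suml; apply: ler_sum => i _; have [_ h _] := st i.
rewrite /segment opprD addrACA subrr add0r -scalerBl enormZ ger0_norm ?subr_ge0//.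
by rewrite ler_wpM2l ?subr_ge0// lerDl.
Qed.

Lemma derive1_segment p q t : derive1 (segment p q) t = q - p.
Proof.
rewrite /derive1; apply: cvg_lim; first exact: norm_hausdorff.
suff E : {near 0^', cst (q - p) =1 (fun h : R => h^-1 *: (segment p q (h + t) - segment p q t))}.
  exact: cvg_trans (near_eq_cvg E) (cvg_cst _).
near=> h.
have h0 : h != 0 by near: h; exact: nbhs_dnbhs_neq.
rewrite /segment scalerDl opprD addrACA subrr add0r addrK scalerA mulVf// scale1r.
by [].
Unshelve. all: by end_near. Qed.

(** The set [I] is left general for two uses: [[0, 1]] bounds the path distance, and [[0, 1[] covers
    a segment whose end lies outside [D]. *)
Lemma curve_length_segment g D (M : R) p q (I : set R) : 0 <= M ->
  (forall x v, D x -> quad (g x) v <= M ^+ 2 * enorm v ^+ 2) ->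
  I `<=` `[0, 1] -> (forall t, I t -> D (segment p q t)) ->
  (curve_length g I (segment p q) <= (M * enorm (q - p))%:E)%E.
Proof.
move=> M0 gM I01 ID.
apply: (@le_trans _ _ (\int[lambda]_(t in I) (M * enorm (q - p))%:E)%E).
  apply: le_lower_integral => t It; rewrite lee_fin ?sqrtr_ge0// derive1_segment.
  apply: le_trans (_ : Num.sqrt (M ^+ 2 * enorm (q - p) ^+ 2) <= _).
    by apply: ler_wsqrtr; apply: gM; exact: ID.
  by rewrite -exprMn sqrtr_sqr ger0_norm// mulr_ge0// enorm_ge0.
apply: (@le_trans _ _ (\int[lambda]_(t in `[0%R, 1%R]) (M * enorm (q - p))%:E)%E).
  by apply: lower_integral_subset => // t _; rewrite lee_fin mulr_ge0// enorm_ge0.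
rewrite integral_cst// [X in (_ * X)%E](_ : _ = 1%E) ?mule1//.
by rewrite [LHS]lebesgue_measure_itv/= lte_fin ltr01 oppr0 adde0.
Qed.

Lemma path_dist_ge0 D g p q : (0 <= path_dist D g p q)%E.
Proof.
apply: le_ereal_inf_tmp => _ [gam _ <-].
by apply: integral_ge0 => t _; rewrite lee_fin sqrtr_ge0.
Qed.

Lemma path_dist_sym D g p q : path_dist D g p q = path_dist D g q p.
Proof.
suff H p' q' : (path_dist D g p' q' <= path_dist D g q' p')%E by apply/le_anti; rewrite !H.
apply: le_ereal_inf_tmp => _ [gam [AC gD g0 g1] <-].
apply: le_trans (curve_length_reverse g AC); apply: ereal_inf_lbound.
exists (fun t => gam (1 - t)) => //; split.
- exact: absolutely_continuous_reverse.
- move=> t /=; rewrite in_itv/= => /andP[t0 t1]; apply: gD; rewrite /= in_itv/=.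
  by apply/andP; split; move: t0 t1; lra.
- by rewrite subr0.
- by rewrite subrr.
Qed.

Lemma path_dist_triangle D g p q r :
  (path_dist D g p r <= path_dist D g p q + path_dist D g q r)%E.
Proof.
have [->|fin1] := eqVneq (path_dist D g p q) +oo%E.
  by rewrite addye ?leey// -ltNye (lt_le_trans _ (path_dist_ge0 _ _ _ _)).
have [->|fin2] := eqVneq (path_dist D g q r) +oo%E.
  by rewrite addey ?leey// -ltNye (lt_le_trans _ (path_dist_ge0 _ _ _ _)).
have f1 : path_dist D g p q \is a fin_num by rewrite ge0_fin_numE ?path_dist_ge0// ltey.
have f2 : path_dist D g q r \is a fin_num by rewrite ge0_fin_numE ?path_dist_ge0// ltey.
apply/lee_addgt0Pr => e e0.
have e20 : 0 < e / 2 by rewrite divr_gt0.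
have [_ [gam1 [AC1 D1 g10 g11] <-] l1] := lb_ereal_inf_adherent e20 f1.
have [_ [gam2 [AC2 D2 g20 g21] <-] l2] := lb_ereal_inf_adherent e20 f2.
have g12 : gam1 1 = gam2 0 by rewrite g11 g20.
apply: (@le_trans _ _ (curve_length g `[0%R, 1%R] (curve_concat gam1 gam2))).
  apply: ereal_inf_lbound; exists (curve_concat gam1 gam2) => //; split.
  - exact: absolutely_continuous_concat.
  - move=> t /=; rewrite in_itv/= => /andP[t0 t1].
    have [tl|tr] := leP t 2^-1.
      by rewrite curve_concatl//; apply: D1; rewrite /= in_itv/=; apply/andP; split; move: t0 tl; lra.
    by rewrite curve_concatr ?(ltW tr)//; apply: D2; rewrite /= in_itv/=; apply/andP; split; move: t1 tr; lra.
  - by rewrite curve_concatl ?mulr0// invr_ge0.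
  - rewrite curve_concatr//; last by rewrite invf_le1// ler1n.
    by rewrite (_ : 2 * 1 - 1 = 1 :> R); [|ring].
apply: le_trans (curve_length_concat g g12 AC1 AC2) _.
by apply: le_trans (leeD (ltW l1) (ltW l2)) _; rewrite addeACA -EFinD -splitr.
Qed.

Lemma path_dist_lower D g (m : R) (p q : 'rV[R]_n) (i : 'I_n) : 0 <= m ->
  (forall x v, D x -> m ^+ 2 * enorm v ^+ 2 <= quad (g x) v) ->
  ((m * `|q 0%R i - p 0%R i|)%:E <= path_dist D g p q)%E.
Proof.
move=> m0 gm; apply: le_ereal_inf_tmp => _ [gam [AC gD <- <-] <-].
by apply: curve_length_lower => // t t01 v; apply: gm; apply: gD; rewrite /= in_itv.
Qed.

Lemma path_dist_upper D g (M : R) p q : 0 <= M ->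
  (forall x v, D x -> quad (g x) v <= M ^+ 2 * enorm v ^+ 2) ->
  (forall t, 0 <= t <= 1 -> D (segment p q t)) ->
  (path_dist D g p q <= (M * enorm (q - p))%:E)%E.
Proof.
move=> M0 gM DS.
have DS' t : `[0, 1]%classic t -> D (segment p q t) by rewrite /= in_itv; exact: DS.
apply: le_trans (curve_length_segment M0 gM (fun t => id) DS').
apply: ereal_inf_lbound; exists (segment p q) => //; split => //.
- exact: absolutely_continuous_segment.
- by rewrite /segment scale0r addr0.
- by rewrite /segment scale1r addrC subrK.
Qed.

End PathDistance.

(** * Completion of a bi-Lipschitz distance *)

Section Completion.
Context {R : realType} {n : nat}.
Local Notation V := 'rV[R]_n.
Variables (D : set V) (m M : R).
Hypotheses (m0 : 0 < m) (mM : m <= M).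

Let M0 : 0 < M. Proof. exact: lt_le_trans mM. Qed.

Lemma closure_normP (p : V) :
  closure D p <-> forall e : R, 0 < e -> exists2 p', D p' & `|p - p'| < e.
Proof.
split=> [cp e e0|H B /nbhs_ballP[e /= e0 pB]].
  have [p' [Dp' pp']] := cp _ (nbhsx_ballx p e e0).
  by exists p' => //; move: pp'; rewrite -ball_normE.
by have [p' Dp' pp'] := H _ e0; exists p'; split=> //; apply: pB; rewrite -ball_normE.
Qed.

(** * Extension of the distance to the closure *)

Section ExtendedDistance.
Variable d : V -> V -> R.
Hypothesis d_sym : forall p q, D p -> D q -> d p q = d q p.
Hypothesis d_tri : forall p q r, D p -> D q -> D r -> d p r <= d p q + d q r.
Hypothesis d_lower : forall p q, D p -> D q -> m * `|p - q| <= d p q.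
Hypothesis d_upper : forall p q, D p -> D q -> d p q <= M * `|p - q|.

Let d_ge0 p q : D p -> D q -> 0 <= d p q.
Proof. by move=> Dp Dq; apply: le_trans (d_lower Dp Dq); rewrite mulr_ge0// ltW. Qed.

(* The largest extension of [d] that is [M]-Lipschitz for the norm. *)
Definition ext_dist (p q : V) : R :=
  inf [set e | exists p' q', [/\ D p', D q' & e = d p' q' + M * `|p - p'| + M * `|q - q'|]].

Let ext_set_lb p q : has_lbound
  [set e | exists p' q', [/\ D p', D q' & e = d p' q' + M * `|p - p'| + M * `|q - q'|]].
Proof.
by exists 0 => _ [p' [q' [Dp' Dq' ->]]]; rewrite !addr_ge0// ?d_ge0// mulr_ge0// ltW.
Qed.

Lemma ext_dist_le p q p' q' : D p' -> D q' ->
  ext_dist p q <= d p' q' + M * `|p - p'| + M * `|q - q'|.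
Proof. by move=> Dp' Dq'; apply: ge_inf; [exact: ext_set_lb|exists p', q']. Qed.

Lemma le_ext_dist p q x : D !=set0 ->
  (forall p' q', D p' -> D q' -> x <= d p' q' + M * `|p - p'| + M * `|q - q'|) ->
  x <= ext_dist p q.
Proof.
move=> [p0 Dp0] H; apply: lb_le_inf; first by eexists; exists p0, p0.
by move=> _ [p' [q' [Dp' Dq' ->]]]; exact: H.
Qed.

Lemma ext_distE p q : D p -> D q -> ext_dist p q = d p q.
Proof.
move=> Dp Dq; apply/eqP; rewrite eq_le; apply/andP; split.
  by have := ext_dist_le p q Dp Dq; rewrite !subrr !normr0 mulr0 !addr0.
apply: le_ext_dist; first by exists p.
move=> p' q' Dp' Dq'.
have h1 := d_tri Dp Dp' Dq; have h2 := d_tri Dp' Dq' Dq.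
have h3 := d_upper Dp Dp'; have h4 := d_upper Dq' Dq.
by rewrite distrC in h4; lra.
Qed.

Lemma ext_dist_sym p q : ext_dist p q = ext_dist q p.
Proof.
rewrite /ext_dist; congr inf; apply/seteqP; split => _ [p' [q' [Dp' Dq' ->]]];
  exists q', p'; split => //; rewrite d_sym//; lra.
Qed.

(** The two infima approximate [q] by different points [q1] and [q2] of [D]; the detour from [q1] to
    [q2] is paid for by the penalties at [q]. *)
Lemma ext_dist_triangle q p r : D !=set0 -> ext_dist p r <= ext_dist p q + ext_dist q r.
Proof.
move=> D0; rewrite -lerBlDr; apply: le_ext_dist => // p1 q1 Dp1 Dq1.
rewrite lerBlDr addrC -lerBlDr; apply: le_ext_dist => // q2 r2 Dq2 Dr2.
have h := ext_dist_le p r Dp1 Dr2.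
have h1 := d_tri Dp1 Dq1 Dr2; have h2 := d_tri Dq1 Dq2 Dr2; have h3 := d_upper Dq1 Dq2.
have h4 : M * `|q1 - q2| <= M * `|q - q1| + M * `|q - q2|.
  rewrite -mulrDr ler_pM2l// (distrC q q1).
  by have := ler_distD q q1 q2.
by lra.
Qed.

(** The penalties carry the weight [M], which is at least [m], and so dominate the displacements of
    [p] and [q] weighted by [m]. *)
Lemma ext_dist_lower p q : D !=set0 -> m * `|p - q| <= ext_dist p q.
Proof.
move=> D0; apply: le_ext_dist => // p' q' Dp' Dq'.
have h1 := d_lower Dp' Dq'.
have h2 : m * `|p - q| <= m * `|p - p'| + m * `|p' - q'| + m * `|q - q'|.
  rewrite -!mulrDr ler_pM2l//.
  have h := ler_distD p' p q; have h' := ler_distD q' p' q.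
  by rewrite (distrC q q'); lra.
have h3 : m * `|p - p'| <= M * `|p - p'| by rewrite ler_wpM2r.
have h4 : m * `|q - q'| <= M * `|q - q'| by rewrite ler_wpM2r.
by lra.
Qed.

Lemma ext_dist_upper p q : closure D p -> closure D q -> ext_dist p q <= M * `|p - q|.
Proof.
move=> /closure_normP cp /closure_normP cq; apply/ler_addgt0Pr => e e0.
(* Two approximation errors, each counted once as a penalty and once in [d p' q'], make four
   quarters of [e]. *)
have M40 : 0 < 4 * M by rewrite mulr_gt0.
have e'0 : 0 < e / (4 * M) by rewrite divr_gt0.
have [p' Dp' pp'] := cp _ e'0; have [q' Dq' qq'] := cq _ e'0.
have h := ext_dist_le p q Dp' Dq'; have h1 := d_upper Dp' Dq'.
have h2 : M * `|p' - q'| <= M * `|p - p'| + M * `|p - q| + M * `|q - q'|.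
  rewrite -!mulrDr ler_pM2l//.
  have k := ler_distD p p' q'; have k' := ler_distD q p q'.
  by rewrite (distrC p p'); lra.
have h3 : M * `|p - p'| <= e / 4.
  apply: le_trans (_ : M * (e / (4 * M)) <= _); first by rewrite ler_pM2l// ltW.
  by rewrite le_eqVlt; apply/orP; left; apply/eqP; field; rewrite gt_eqF.
have h4 : M * `|q - q'| <= e / 4.
  apply: le_trans (_ : M * (e / (4 * M)) <= _); first by rewrite ler_pM2l// ltW.
  by rewrite le_eqVlt; apply/orP; left; apply/eqP; field; rewrite gt_eqF.
by lra.
Qed.

(** Off the closure [ext_dist p p] is positive, so the metric lives on the closure only.
    Nonemptiness is an argument of the type because the metric laws use it. *)
Definition closure_type of D !=set0 := {p : V | p \in closure D}.

Variable D0 : D !=set0.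
Local Notation X := (closure_type D0).

Let dist (x y : X) : R := ext_dist (sval x) (sval y).

Let dist_xx x : dist x x = 0.
Proof.
apply/eqP; rewrite eq_le; apply/andP; split.
  have /set_mem cx := svalP x.
  by have := ext_dist_upper cx cx; rewrite subrr normr0 mulr0.
by have := ext_dist_lower (sval x) (sval x) D0; rewrite subrr normr0 mulr0.
Qed.

Let dist_positivity x y : dist x y = 0 -> x = y.
Proof.
move=> xy; apply: val_inj => /=; apply/eqP; rewrite -subr_eq0 -normr_le0.
have := ext_dist_lower (sval x) (sval y) D0.
by rewrite -/(dist x y) xy pmulr_rle0.
Qed.

Let dist_sym x y : dist x y = dist y x. Proof. exact: ext_dist_sym. Qed.

Let dist_triangle y x z : dist x z <= dist x y + dist y z.
Proof. exact: ext_dist_triangle. Qed.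

#[local] HB.instance Definition _ := Choice.on X.
#[local] HB.instance Definition _ := isMetric.Build R X dist_xx dist_positivity dist_sym dist_triangle.

(** The model is the closure with [ext_dist]. By the lower bound a Cauchy filter for [ext_dist] is
    Cauchy for the norm; its limit lies in the closure, and the upper bound returns the convergence
    to [ext_dist]. *)
Lemma metric_completion_exists : exists (Y : metricType R) (iota : V -> Y),
  is_metric_completion D (fun p q => (d p q)%:E) iota.
Proof.
have [p0 Dp0] := D0.
have Dcl p : D p -> p \in closure D by move=> Dp; rewrite inE; exact: subset_closure.
pose iota (p : V) : X :=
  if pselect (D p) is left Dp then exist _ p (Dcl p Dp) else exist _ p0 (Dcl p0 Dp0).
have iotaE p : D p -> sval (iota p) = p by rewrite /iota; case: pselect.
exists X, iota; split.
- move=> p q Dp Dq; congr _%:E.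
  by rewrite -[mdist _ _]/(ext_dist (sval (iota p)) (sval (iota q))) !iotaE// ext_distE.
- move=> O [x Ox] oO; have : nbhs x O by rewrite nbhsE/=; exists O.
  move=> /nbhs_ballP[e /= e0 xe].
  have /set_mem/closure_normP := svalP x.
  have eM0 : 0 < e / M by rewrite divr_gt0.
  move=> /(_ _ eM0)[p Dp xp]; exists (iota p); split; last by exists p.
  apply: xe; rewrite ballEmdist /= -[mdist _ _]/(ext_dist (sval x) (sval (iota p))) iotaE//.
  apply: le_lt_trans (ext_dist_upper _ _) _; first exact/set_mem/(svalP x).
    exact: subset_closure.
  by rewrite mulrC -ltr_pdivlMr.
- move=> F PF cF.
  have PG : ProperFilter ((sval : X -> V) @ F) by exact: fmap_proper_filter.
  have cG : cauchy ((sval : X -> V) @ F).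
    apply: cauchy_exP => e e0.
    have em0 : 0 < m * e by rewrite mulr_gt0.
    have [x Fx] := (cauchyP F).1 cF _ em0.
    exists (sval x); change (F (fun y => ball (sval x) e (sval y))).
    apply: filterS Fx => y.
    rewrite ballEmdist /= -[mdist _ _]/(ext_dist (sval x) (sval y)) => xy.
    rewrite -ball_normE /=; rewrite -(ltr_pM2l m0).
    exact: le_lt_trans (ext_dist_lower _ _ D0) xy.
  have [q Gq] : exists q : V, (sval : X -> V) @ F --> q by apply/cvg_ex; exact: cauchy_cvg.
  have cq : q \in closure D.
    rewrite inE; apply: (closed_cvg (closure D) _ _ q Gq); first exact: closed_closure.
    by apply: nearW => x; exact/set_mem/(svalP x).
  exists (exist _ q cq : X); apply/cvg_ballP => e e0.
  have eM0 : 0 < e / M by rewrite divr_gt0.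
  move/cvg_ballP : Gq => /(_ _ eM0); apply: filterS => y.
  rewrite -ball_normE /= => qy; rewrite ballEmdist /= -[mdist _ _]/(ext_dist q (sval y)).
  apply: le_lt_trans (ext_dist_upper _ _) _; [exact/set_mem/cq|exact/set_mem/(svalP y)|].
  by rewrite mulrC -ltr_pdivlMr.
Qed.

End ExtendedDistance.

(** * Comparison of an arbitrary completion with the closure *)

Section Homeomorphism.
Variables (Y : metricType R) (iota : V -> Y).
Hypothesis iota_dense : dense (iota @` D).
Hypothesis Y_complete : forall F : set_system Y, ProperFilter F -> cauchy F ->
  exists x : Y, F --> x.
Hypothesis iota_lower : forall p q, D p -> D q -> m * `|p - q| <= mdist (iota p) (iota q).
Hypothesis iota_upper : forall p q, D p -> D q -> mdist (iota p) (iota q) <= M * `|p - q|.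

(* The closure of the graph of [iota], read backwards. *)
Let lim_rel (x : Y) (q : V) := forall e : R, 0 < e ->
  exists p, [/\ D p, `|q - p| < e & mdist x (iota p) < e].

(** Both Lipschitz bounds survive in the limit, which makes [lim_rel] the graph of a bijection: the
    lower bound gives uniqueness of [q], the upper bound uniqueness of [x]. *)
Let lim_rel_lower x q x' q' : lim_rel x q -> lim_rel x' q' -> m * `|q - q'| <= mdist x x'.
Proof.
move=> xq xq'; apply/ler_addgt0Pr => e e0.
(* Two errors in the norm, weighted by [m], and two in [mdist] account for [2 * m + 2]. *)
have e'0 : 0 < e / (2 * m + 2) by rewrite divr_gt0// addr_gt0// mulr_gt0.
have [p [Dp qp xp]] := xq _ e'0; have [p' [Dp' qp' xp']] := xq' _ e'0.
set e' := _ / _ in e'0 qp xp qp' xp'.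
have eE : e = (2 * m + 2) * e' by rewrite /e' mulrC divfK// gt_eqF// addr_gt0// mulr_gt0.
have h := iota_lower Dp Dp'.
have h1 : m * `|q - q'| <= m * e' + m * `|p - p'| + m * e'.
  rewrite -!mulrDr ler_pM2l//.
  have k := ler_distD p q q'; have k' := ler_distD p' p q'.
  by rewrite (distrC p' q') in k'; lra.
have t1 := metric_triangle (iota p) x (iota p'); have t2 := metric_triangle x x' (iota p').
rewrite (metric_sym (iota p) x) in t1.
by lra.
Qed.

Let lim_rel_upper x q x' q' : lim_rel x q -> lim_rel x' q' -> mdist x x' <= M * `|q - q'|.
Proof.
move=> xq xq'; apply/ler_addgt0Pr => e e0.
have e'0 : 0 < e / (2 * M + 2) by rewrite divr_gt0// addr_gt0// mulr_gt0.
have [p [Dp qp xp]] := xq _ e'0; have [p' [Dp' qp' xp']] := xq' _ e'0.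
set e' := _ / _ in e'0 qp xp qp' xp'.
have eE : e = (2 * M + 2) * e' by rewrite /e' mulrC divfK// gt_eqF// addr_gt0// mulr_gt0.
have h := iota_upper Dp Dp'.
have h1 : M * `|p - p'| <= M * e' + M * `|q - q'| + M * e'.
  rewrite -!mulrDr ler_pM2l//.
  have k := ler_distD q p p'; have k' := ler_distD q' q p'.
  by rewrite (distrC p q) in k; lra.
have t1 := metric_triangle x (iota p) x'; have t2 := metric_triangle (iota p) (iota p') x'.
rewrite (metric_sym (iota p') x') in t2.
by lra.
Qed.

Let lim_rel_iota p : D p -> lim_rel (iota p) p.
Proof. by move=> Dp e e0; exists p; rewrite subrr normr0 mdistxx. Qed.

Let lim_rel_closure x q : lim_rel x q -> closure D q.
Proof. by move=> xq; apply/closure_normP => e /xq[p [Dp qp _]]; exists p. Qed.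

(** The trace on [D] of the neighbourhoods of [q] is mapped by [iota] to a Cauchy filter, thanks to
    the upper bound. *)
Let lim_rel_right q : closure D q -> exists x, lim_rel x q.
Proof.
move=> cq; have PF : ProperFilter (within D (nbhs q)) by exact: within_nbhs_proper.
have [x Fx] : exists x : Y, iota @ within D (nbhs q) --> x.
  apply: Y_complete; apply: cauchy_exP => e e0.
  have e'0 : 0 < e / (2 * M) by rewrite divr_gt0// mulr_gt0.
  have [p Dp qp] := (closure_normP q).1 cq _ e'0.
  exists (iota p).
  change (nbhs q (fun y => D y -> ball (iota p) e (iota y))).
  apply/nbhs_ballP; exists (e / (2 * M)) => //= y; rewrite -ball_normE /= => qy Dy.
  rewrite ballEmdist /=; apply: le_lt_trans (iota_upper Dp Dy) _.
  rewrite mulrC -ltr_pdivlMr//.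
  have k := ler_distD q p y; rewrite (distrC p q) in k.
  have -> : e / M = e / (2 * M) + e / (2 * M) by field; rewrite gt_eqF.
  by lra.
exists x => e e0; move/cvg_ballP : Fx => /(_ _ e0).
move=> /= /nbhs_ballP[e1 /= e10 H].
have e20 : 0 < Num.min e e1 by rewrite lt_min e0.
have [p Dp qp] := (closure_normP q).1 cq _ e20.
move: qp; rewrite lt_min => /andP[qp qp1].
exists p; split=> //; have := H p; rewrite -ball_normE /= => /(_ qp1 Dp).
by rewrite ballEmdist.
Qed.

(** Density provides a sequence in [D] whose images tend to [x]; the lower bound makes the sequence
    Cauchy in a complete space. *)
Let lim_rel_left x : exists q, lim_rel x q.
Proof.
have approx (k : nat) : exists p, D p /\ mdist x (iota p) < k.+1%:R^-1.
  have k0 : 0 < k.+1%:R^-1 :> R by rewrite invr_gt0.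
  have [|y [xy [p Dp py]]] := iota_dense (O := (ball x k.+1%:R^-1)^°) _ (open_interior _).
    by exists x; exact: nbhsx_ballx.
  by exists p; split=> //; move: xy => /interior_subset; rewrite -py ballEmdist.
have [p hp] := choice approx.
have small e : 0 < e -> \forall k \near \oo, mdist x (iota (p k)) < e.
  move=> e0; near=> k; apply: lt_trans (hp k).2 _.
  by near: k; exact: near_infty_natSinv_lt (PosNum e0).
have cp : cauchy (p @ \oo).
  apply: cauchy_exP => e e0.
  have e'0 : 0 < m * e / 2 by rewrite divr_gt0// mulr_gt0.
  have [N _ HN] := small _ e'0.
  exists (p N); exists N => // k /= Nk; rewrite -ball_normE /= -(ltr_pM2l m0).
  apply: le_lt_trans (iota_lower (hp _).1 (hp _).1) _.
  apply: le_lt_trans (metric_triangle _ x _) _.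
  rewrite metric_sym (splitr (m * e)) ltrD//; apply: HN => //=.
have [q pq] : exists q : V, p @ \oo --> q by apply/cvg_ex; exact: cauchy_cvg.
exists q => e e0.
have [N1 _ H1] := small _ e0.
have [N2 _ H2] : \forall k \near \oo, `|q - p k| < e by move/cvgrPdist_lt : pq; exact.
exists (p (maxn N1 N2)); split; first exact: (hp _).1.
- by apply: H2; rewrite /= leq_maxr.
- by apply: H1; rewrite /= leq_maxl.
Unshelve. all: by end_near. Qed.

(** Both directions are Lipschitz: [h] with constant [m^-1], and its inverse on the closure with
    constant [M]. *)
Lemma completion_homeomorphism : exists h : Y -> V,
  homeomorphism_onto (closure D) h /\ forall p, D p -> h (iota p) = p.
Proof.
have [h hE] := choice lim_rel_left.
have uniq_r x q q' : lim_rel x q -> lim_rel x q' -> q = q'.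
  move=> xq xq'; have := lim_rel_lower xq xq'; rewrite mdistxx pmulr_rle0// normr_le0.
  by rewrite subr_eq0 => /eqP.
(* [choice] asks for a value at every [q]; off the closure [iota q] is a dummy. *)
have inv q : exists x, closure D q -> lim_rel x q.
  have [cq|ncq] := pselect (closure D q); last by exists (iota q).
  by have [x xq] := lim_rel_right cq; exists x.
have [h' h'E] := choice inv.
exists h; split; last by move=> p Dp; exact: uniq_r (hE _) (lim_rel_iota Dp).
split.
- move=> x; apply/cvgrPdist_lt => e e0; apply/nbhs_ballP; exists (m * e) => /=.
    by rewrite mulr_gt0.
  move=> y; rewrite ballEmdist /= => xy; rewrite -(ltr_pM2l m0).
  exact: le_lt_trans (lim_rel_lower (hE x) (hE y)) xy.
- apply/seteqP; split => [_ [x _ <-]|q cq]; first exact: lim_rel_closure (hE x).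
  by exists (h' q) => //; exact: uniq_r (hE _) (h'E _ cq).
- exists h'; split.
    move=> x; have cx := lim_rel_closure (hE x).
    have := lim_rel_upper (h'E _ cx) (hE x); rewrite subrr normr0 mulr0 => le0.
    by apply: mdist_positivity; apply/eqP; rewrite eq_le le0 mdist_ge0.
  apply/subspace_continuousP => q cq; apply/cvg_ballP => e e0.
  apply/nbhs_ballP; exists (e / M) => /=; first by rewrite divr_gt0.
  move=> y; rewrite -ball_normE /= => qy cy; rewrite ballEmdist /=.
  apply: le_lt_trans (lim_rel_upper (h'E _ cq) (h'E _ cy)) _.
  by rewrite mulrC -ltr_pdivlMr.
Qed.

End Homeomorphism.
End Completion.

(** * The corner model *)

Section DiracCorner.
Context {R : realType}.
Local Notation M2 := (measurableTypeR R * measurableTypeR R)%type.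

Lemma measurable_set1_prod (a : M2) : measurable [set a].
Proof.
have -> : [set a] = [set a.1] `*` [set a.2].
  by apply/seteqP; split => [x ->//|[x y] /= [-> ->]]; case: a.
by apply: measurableX; exact: measurable_set1.
Qed.

(** On the singleton [f] agrees with a constant, so an arbitrary function can be integrated
    there. *)
Lemma Rintegral_dirac_set1 (a : M2) (f : M2 -> R) :
  (\int[(\d_a : {measure set M2 -> \bar R})]_(x in [set a]) f x)%R = f a.
Proof.
rewrite /Rintegral (eq_integral (cst (f a)%:E)); last first.
  by move=> x /set_mem ->.
have ma := measurable_set1_prod a.
rewrite integral_cst//=.
by rewrite indicE mem_set// mulr1.
Qed.

(** The complement of the point is open and has mass zero. *)
Lemma msupport_dirac (a : R * R) :
  msupport (\d_(a : M2) : {measure set M2 -> \bar R}) = [set a].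
Proof.
apply/seteqP; split => [x|_ -> O _ Oa]; last by rewrite /= diracE mem_set// lte01.
move=> H; apply: contrapT => xa.
have oC : open (~` [set a]).
  apply: closed_openC; apply: accessible_closed_set1; apply: hausdorff_accessible.
  exact: norm_hausdorff.
by have := H _ oC xa; rewrite /= diracE memNset//= ltxx.
Qed.

Lemma maximum_set1 (x : R) : maximum [set x] = x.
Proof.
rewrite /maximum; case: xgetP => [y _ [-> //]|/(_ x) []].
by split => // y ->.
Qed.

End DiracCorner.

(** * Convexity and closure of the box *)

Section CornerBox.
Context {R : realType} {k : nat}.
Implicit Types (p q : 'rV[R]_(2 + k)) (B : set 'rV[R]_k).

Lemma cxE p q (t : R) : cx (p + t *: (q - p)) = cx p + t * (cx q - cx p).
Proof. by rewrite /cx !mxE. Qed.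

Lemma cyE p q (t : R) : cy (p + t *: (q - p)) = cy p + t * (cy q - cy p).
Proof. by rewrite /cy !mxE. Qed.

Lemma czE p q (t : R) : cz (p + t *: (q - p)) = cz p + t *: (cz q - cz p).
Proof. by apply/rowP => i; rewrite !mxE. Qed.

Lemma row_coord_le n (v : 'rV[R]_n) i : `|v 0 i| <= `|v|.
Proof. by rewrite [leRHS]mx_normrE (le_bigmax _ _ (0, i)). Qed.

Lemma cx_le p q : `|cx p - cx q| <= `|p - q|.
Proof.
rewrite (_ : cx p - cx q = (p - q) 0 (lshift k 0)); last by rewrite /cx !mxE.
exact: row_coord_le.
Qed.

Lemma cy_le p q : `|cy p - cy q| <= `|p - q|.
Proof.
rewrite (_ : cy p - cy q = (p - q) 0 (lshift k 1)); last by rewrite /cy !mxE.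
exact: row_coord_le.
Qed.

Lemma cz_le p q : `|cz p - cz q| <= `|p - q|.
Proof.
apply: norm_le_coord => // i.
rewrite (_ : _ 0 i = (p - q) 0 (rshift 2 i)); last by rewrite /cz !mxE.
exact: row_coord_le.
Qed.

Definition corner_row (x y : R) (z : 'rV[R]_k) : 'rV[R]_(2 + k) :=
  row_mx (\row_(i < 2) if i == 0 then x else y) z.

Lemma corner_rowE x y z :
  [/\ cx (corner_row x y z) = x, cy (corner_row x y z) = y & cz (corner_row x y z) = z].
Proof. by rewrite /cx /cy /cz /corner_row row_mxKl row_mxKr !mxE/=. Qed.

Lemma norm_le_corner p q (e : R) : 0 <= e -> `|cx p - cx q| <= e -> `|cy p - cy q| <= e ->
  `|cz p - cz q| <= e -> `|p - q| <= e.
Proof.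
move=> e0 hx hy hz; apply: norm_le_coord => // i.
rewrite -(splitK i); case: (fintype.split i) => [j|j] /=.
- have [->|->] : j = 0 \/ j = 1.
    by case: j => -[|[|//]] ?; [left|right]; exact: val_inj.
  + by rewrite (_ : _ 0 _ = cx p - cx q)// /cx !mxE.
  + by rewrite (_ : _ 0 _ = cy p - cy q)// /cy !mxE.
- rewrite (_ : _ 0 _ = (cz p - cz q) 0 j); last by rewrite /cz !mxE.
  exact: le_trans (row_coord_le _ _) hz.
Qed.

Lemma eball_convex (b z1 z2 : 'rV[R]_k) (r t : R) : 0 <= t <= 1 ->
  eball b r z1 -> eball b r z2 -> eball b r (z1 + t *: (z2 - z1)).
Proof.
move=> /andP[t0 t1] h1 h2; rewrite /eball /=.
have -> : z1 + t *: (z2 - z1) - b = (1 - t) *: (z1 - b) + t *: (z2 - b).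
  by apply/rowP => i; rewrite !mxE; ring.
apply: le_lt_trans (enormD _ _) _; rewrite !enormZ ger0_norm ?subr_ge0// ger0_norm//.
(* Comparison with the larger of the two norms keeps the inequality strict also for [t] equal to 0
   or 1. *)
set mx := Num.max (enorm (z1 - b)) (enorm (z2 - b)).
have mxr : mx < r by rewrite gt_max; apply/andP.
apply: le_lt_trans mxr; have -> : mx = (1 - t) * mx + t * mx by ring.
by rewrite lerD// ler_wpM2l ?subr_ge0// le_max lexx ?orbT.
Qed.

Lemma itv_approx (eps x e : R) : 0 < eps -> 0 <= x <= eps -> 0 < e ->
  exists2 x', 0 < x' < eps & `|x - x'| < e.
Proof.
move=> eps0 /andP[x0 xe] e0.
(* Moving [x] by a fraction [s] of the way to the midpoint [eps / 2] lands strictly inside;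
   [s <= e / eps] keeps the displacement within [e / 2]. *)
pose s := Num.min 2^-1 (e / eps).
have s0 : 0 < s by rewrite lt_min invr_gt0 ltr0n divr_gt0.
have s1 : s <= 2^-1 by rewrite ge_min lexx.
have se : s * eps <= e by rewrite -ler_pdivlMr// ge_min lexx orbT.
exists (x + s * (eps / 2 - x)).
  have h1 : s * x <= 2^-1 * x by rewrite ler_wpM2r.
  have h2 : 0 < s * eps by rewrite mulr_gt0.
  have h3 : s * (eps - x) <= 2^-1 * (eps - x) by rewrite ler_wpM2r// subr_ge0.
  by apply/andP; split; lra.
rewrite opprD addNKr normrN normrM gtr0_norm//.
apply: le_lt_trans (_ : s * (eps / 2) < e).
  by rewrite ler_pM2l// ler_norml; apply/andP; split; lra.
have h2 : 0 < s * eps by rewrite mulr_gt0.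
by lra.
Qed.

Lemma closure_box (eps : R) B : 0 < eps ->
  closure (box `]0, eps[ B) = box `[0, eps] (closure B).
Proof.
move=> eps0; apply/seteqP; split => p.
- move=> /closure_normP H.
  have Hx (c : 'rV[R]_(2 + k) -> R) : (forall q, `|c p - c q| <= `|p - q|) ->
      (forall q, box `]0, eps[ B q -> 0 < c q < eps) -> `[0, eps]%classic (c p).
    move=> cle cin; rewrite /= in_itv/=; apply/andP; split.
    + apply/ler_addgt0Pr => e /H[q /cin/andP[q0 _]] /(le_lt_trans (cle q)).
      by rewrite ltr_norml => /andP[? _]; lra.
    + apply/ler_addgt0Pr => e /H[q /cin/andP[_ q1]] /(le_lt_trans (cle q)).
      by rewrite ltr_norml => /andP[_ ?]; lra.
  split.
  + by apply: Hx => [q|q []]; [exact: cx_le|rewrite /= in_itv].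
  + by apply: Hx => [q|q []]; [exact: cy_le|move=> _; rewrite /= in_itv].
  + apply/closure_normP => e /H[q [_ _ Bq] pq]; exists (cz q) => //.
    exact: le_lt_trans (cz_le _ _) pq.
- move=> [/=]; rewrite !in_itv/= => px py /closure_normP pz.
  apply/closure_normP => e e0; have e20 : 0 < e / 2 by rewrite divr_gt0.
  have [x' x'0 hx] := itv_approx eps0 px e20; have [y' y'0 hy] := itv_approx eps0 py e20.
  have [z' Bz' hz] := pz _ e20.
  have [Ex Ey Ez] := corner_rowE x' y' z'.
  exists (corner_row x' y' z'); first by split; rewrite ?Ex ?Ey ?Ez//= in_itv.
  apply: le_lt_trans (_ : e / 2 < e); last by rewrite ltr_pdivrMr// ltr_pMr// ltr1n.
  by apply: norm_le_corner; rewrite ?Ex ?Ey ?Ez; exact: ltW.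
Qed.

End CornerBox.

(** * The Dirac mass at [(2, 0)] with coefficient [x ^+ 2] *)

Theorem proposition10p1 (R : realType) (k : nat) (V : set 'rV[R]_k) (eps : R)
    (g0 : 'rV[R]_(2 + k) -> 'M[R]_(2 + k)) (c0 C0 : R) (b : 'rV[R]_k) (r : R)
    (u : R * R -> 'rV[R]_(2 + k) -> R) :
  open V -> 0 < eps < 1 ->
  smooth_riemannian_metric (box `[0, eps[ V) g0 ->
  0 < c0 <= C0 -> euclidean_bounds (box `[0, eps[ V) c0 C0 g0 ->
  0 < r -> compact (closure (eball b r)) -> closure (eball b r) `<=` V ->
  (forall p, box `]0, eps[ V p -> u (2, 0) p = cx p ^+ 2) ->
  let mu : {measure set (measurableTypeR R * measurableTypeR R) -> \bar R} :=
    \d_((2, 0) : measurableTypeR R * measurableTypeR R) in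
  let B := eball b r in
  let UB := box `]0, eps[ B in
  let clUB := box `[0, eps] (closure B) in
  let g := g_mu mu u g0 in
  let d := path_dist UB g in
  msupport mu = [set (2, 0)] /\
  A_mu mu = 2 /\
  (forall S : R, T_mu mu S = 1) /\
  (forall S0 : R,
    (\int[lebesgue_measure]_(S in `[S0, +oo[) (Num.sqrt (T_mu mu S))%:E
     = +oo)%E) /\
  (forall p, box `]0, eps[ V p -> F_mu mu u p = 1) /\
  closure UB = clUB /\
  (exists (X : metricType R) (iota : 'rV[R]_(2 + k) -> X),
    is_metric_completion UB d iota) /\
  (forall (X : metricType R) (iota : 'rV[R]_(2 + k) -> X),
    is_metric_completion UB d iota ->
    exists h : X -> 'rV[R]_(2 + k),
      [/\ homeomorphism_onto clUB h,
          (forall p, UB p -> h (iota p) = p) &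
          (forall q, corner_points B q -> exists c : X, h c = q)]) /\
  (forall p q, UB p -> corner_points B q ->
    reached_with_finite_length UB g p q).
Proof.
move=> _ /andP[eps0 _] _ /andP[c00 cC0] bnd r0 _ BV uE mu B UB clUB g d.
have supp : msupport mu = [set (2, 0)] by exact: msupport_dirac.
have TE S : T_mu mu S = 1.
  rewrite /T_mu supp [LHS]Rintegral_dirac_set1 /= subrr subr0 mulr0 expR0.
  by [].
have FE p : box `]0, eps[ V p -> F_mu mu u p = 1.
  move=> Up; rewrite /F_mu supp [LHS]Rintegral_dirac_set1 /= uE//.
  have x0 : 0 < cx p by case: Up => /=; rewrite in_itv/= => /andP[].
  (* The exponent of [y] is zero, and positivity of [x] makes the remaining two powers inverse to
     each other. *)
  by rewrite oppr0 powRr0 mulr1 powRN powR_mulrn ?ltW// mulfV// expf_neq0// gt_eqF.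
have UBV p : UB p -> box `]0, eps[ V p.
  by move=> [px py pz]; split=> //; apply: BV; exact: subset_closure.
have gE p : UB p -> g p = g0 p.
  by move=> Up; rewrite /g /g_mu FE ?scale1r//; exact: UBV.
have UBbox p : UB p -> box `[0, eps[ V p.
  move=> /UBV[px py pz]; split=> //; [move: px|move: py]; rewrite /= !in_itv/=;
  by move=> /andP[/ltW -> ->].
pose m := Num.sqrt c0; pose M := Num.sqrt C0.
have C00 : 0 < C0 by exact: lt_le_trans cC0.
have m0 : 0 < m by rewrite sqrtr_gt0.
have M0 : 0 < M by rewrite sqrtr_gt0.
have gm p v : UB p -> m ^+ 2 * enorm v ^+ 2 <= quad (g p) v.
  by move=> Up; rewrite gE// /m sqr_sqrtr ?(ltW c00)//; case/andP: (bnd _ (UBbox _ Up) v).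
have gM p v : UB p -> quad (g p) v <= M ^+ 2 * enorm v ^+ 2.
  by move=> Up; rewrite gE// /M sqr_sqrtr ?(ltW C00)//; case/andP: (bnd _ (UBbox _ Up) v).
have convUB p q t : UB p -> UB q -> 0 <= t <= 1 -> UB (segment p q t).
  move=> [/=]; rewrite !in_itv/= => px py pz [/=]; rewrite !in_itv/= => qx qy qz t01.
  have conv x y : 0 < x < eps -> 0 < y < eps -> 0 < x + t * (y - x) < eps.
    move=> /andP[x0 x1] /andP[y0 y1]; move: t01 => /andP[t0 t1].
    have -> : x + t * (y - x) = (1 - t) * x + t * y by ring.
    (* Strict positivity comes from the term [t * y], so [t = 0] is treated apart. *)
    have [->|t'] := eqVneq t 0; first by rewrite subr0 mul1r mul0r addr0 x0.
    have tp : 0 < t by rewrite lt_neqAle eq_sym t'.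
    have h1 : 0 <= (1 - t) * x by rewrite mulr_ge0 ?subr_ge0 ?(ltW x0).
    have h2 : 0 < t * y by rewrite mulr_gt0.
    have h3 : (1 - t) * x <= (1 - t) * eps by rewrite ler_wpM2l ?subr_ge0 ?(ltW x1).
    have h4 : t * y < t * eps by rewrite ltr_pM2l.
    by apply/andP; split; lra.
  rewrite /segment; split; rewrite ?cxE ?cyE ?czE /= ?in_itv/=; [exact: conv..|].
  exact: eball_convex.
(* The extra factor converts [enorm] to the maximum norm, in which the completion lemmas are
   stated. *)
pose M' := M * (2 + k).+1%:R.
have mM' : m <= M'.
  apply: le_trans (_ : M <= _); first exact: ler_wsqrtr.
  by rewrite /M' ler_peMr ?(ltW M0)// ler1n.
have d_up p q : UB p -> UB q -> (d p q <= (M' * `|p - q|)%:E)%E.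
  move=> Up Uq; apply: le_trans (path_dist_upper (ltW M0) gM _) _.
    by move=> t t01; exact: convUB.
  by rewrite lee_fin /M' -mulrA ler_pM2l// distrC enorm_le_norm.
have d_fin p q : UB p -> UB q -> d p q = (fine (d p q))%:E.
  move=> Up Uq; rewrite fineK// ge0_fin_numE ?path_dist_ge0//.
  by apply: le_lt_trans (d_up _ _ Up Uq) _; rewrite ltry.
have d_low p q : UB p -> UB q -> m * `|p - q| <= fine (d p q).
  move=> Up Uq; rewrite mulrC -ler_pdivlMr//; apply: norm_le_coord.
    by rewrite divr_ge0 ?(ltW m0)// fine_ge0// path_dist_ge0.
  move=> i; rewrite ler_pdivlMr// mulrC -lee_fin -d_fin// /d path_dist_sym.
  have := @path_dist_lower _ _ UB g m q p i (ltW m0) gm.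
  by rewrite !mxE.
have UB0 : UB !=set0.
  exists (corner_row (eps / 2) (eps / 2) b).
  have [Ex Ey Ez] := corner_rowE (eps / 2) (eps / 2) b.
  have h : 0 < eps / 2 < eps by apply/andP; split; lra.
  split; rewrite ?Ex ?Ey ?Ez /= ?in_itv//.
  by rewrite /B /eball /= subrr enorm0.
have clUBE : closure UB = clUB by exact: closure_box.
split=> //; split.
  rewrite /A_mu supp image_set1 maximum_set1 /= addr0.
  by [].
split=> //; split.
  move=> S0; under eq_integral do rewrite TE sqrtr1.
  by rewrite integral_cst//= lebesgue_measure_itv/= ltry mul1e.
split=> //; split=> //; split.
  have [||||X [iota [Xd Xdense Xc]]] :=
    @metric_completion_exists R _ UB m M' m0 mM' (fun p q => fine (d p q)) _ _ _ _ UB0.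
  - by move=> p q _ _; rewrite /d path_dist_sym.
  - move=> p q s Up Uq Us; rewrite -lee_fin EFinD -!d_fin//; exact: path_dist_triangle.
  - exact: d_low.
  - by move=> p q Up Uq; rewrite -lee_fin -d_fin//; exact: d_up.
  exists X, iota; split=> // p q Up Uq; rewrite d_fin//; exact: Xd.
split.
  move=> X iota [Xd Xdense Xc].
  have Xd' p q : UB p -> UB q -> mdist (iota p) (iota q) = fine (d p q).
    by move=> Up Uq; rewrite Xd.
  have [||h [hh hiota]] := @completion_homeomorphism R _ UB m M' m0 mM' X iota Xdense Xc.
  - by move=> p q Up Uq; rewrite Xd'// d_low.
  - by move=> p q Up Uq; rewrite Xd'// -lee_fin -d_fin// d_up.
  exists h; split=> //; first by rewrite -clUBE.
  move=> q [/= qx qy Bq]; have [_ hr _] := hh.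
  (* A corner point lies in the closure because 0 is an end of [[0, eps]]; surjectivity of [h] onto
     the closure gives its preimage. *)
  have : closure UB q.
    rewrite clUBE; split; last exact: subset_closure.
      by rewrite qx /= in_itv/= lexx ltW.
    by rewrite qy /= in_itv/= lexx ltW.
  by rewrite -hr => -[c _ <-]; exists c.
move=> p q Up [/= qx qy Bq].
(* The coordinates [x] and [y] shrink by the factor [1 - t], so the segment leaves the open box only
   at time 1. *)
have segUB t : 0 <= t < 1 -> UB (segment p q t).
  move=> /andP[t0 t1]; move: (Up) => [/=]; rewrite !in_itv/= => px py pz.
  have conv x : 0 < x < eps -> 0 < x + t * (0 - x) < eps.
    move=> /andP[x0 x1]; have -> : x + t * (0 - x) = (1 - t) * x by ring.
    rewrite mulr_gt0 ?subr_gt0//=; apply: le_lt_trans x1.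
    by rewrite ler_piMl ?(ltW x0)// gerBl.
  rewrite /segment; split; rewrite ?cxE ?cyE ?czE ?qx ?qy /= ?in_itv/=; [exact: conv..|].
  by apply: eball_convex => //; rewrite t0 ltW.
exists (segment p q); split=> //.
- by move=> t _; exact: absolutely_continuous_segment.
- by rewrite /segment scale0r addr0.
- apply/cvgrPdist_lt => e e0.
  have K0 : 0 < `|q - p| + 1 by rewrite ltr_wpDl.
  have eK0 : 0 < e / (`|q - p| + 1) by rewrite divr_gt0.
  near=> t.
  rewrite /segment opprD addrA -{1}[q - p]scale1r -scalerBl normrZ.
  apply: le_lt_trans (_ : `|1 - t| * (`|q - p| + 1) < e).
    by rewrite ler_wpM2l// lerDl.
  rewrite -ltr_pdivlMr//; near: t.
  by apply: cvgr_dist_lt => //; apply: cvg_at_left_filter; exact: cvg_id.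
- apply: (@le_lt_trans _ _ (M * enorm (q - p))%:E); last by rewrite ltry.
  apply: (curve_length_segment (ltW M0) gM) => t /=; rewrite !in_itv/=.
    by move=> /andP[-> /ltW].
  exact: segUB.
Unshelve. all: by end_near. Qed.
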